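(* Let $\lambda,\mu\in\mathbb{K}$. Then $\dim \mathrm{H}^1_{\mathrm{diff}}(\mathcal{K}(1),\mathfrak{osp}(1|2);\mathfrak{D}_{\lambda,\mu})=1$ if one of the following holds: \begin{itemize} \item $\mu-\lambda=\frac32$ and $\lambda\neq-\frac12$; \item $\mu-\lambda=2$ (for all $\lambda$); \item $\mu-\lambda=\frac52$ and $\lambda\neq-1$; \item $\mu-\lambda=3$ and $\lambda\in\{0,-\frac52\}$; \item $\mu-\lambda=4$ and $\lambda=\frac{-7\pm\sqrt{33}}{4}$. \end{itemize} Otherwise, $\mathrm{H}^1_{\mathrm{diff}}(\mathcal{K}(1),\mathfrak{osp}(1|2);\mathfrak{D}_{\lambda,\mu})=0$. The corresponding (one-dimensional) spaces $\mathrm{H}^1_{\mathrm{diff}}(\mathcal{K}(1),\mathfrak{osp}(1|2);\mathfrak{D}_{\lambda,\lambda+\frac k2})$ are spanned by the cohomology classes of $\Upsilon_{\lambda,\lambda+\frac k2}=\mathfrak{J}^{-1,\lambda}_{\frac k2+1}$, where $k\in\{3,4,5,6,8\}$ (the supertransvectants given explicitly, up to normalization, in the context).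
   Context: Let $\mathbb{K}=\mathbb{R}$ or $\mathbb{C}$ and let $\mathbb{K}[x,\theta]$ be the superalgebra of polynomials in an even variable $x$ and an odd variable $\theta$ ($\theta^2=0$); $p(\cdot)$ denotes parity, $F'=\partial_xF$, $F^{(i)}=\partial_x^iF$. Put $\overline{\eta}=\partial_\theta-\theta\partial_x$ (so $\overline\eta^2=-\partial_x$). The Lie superalgebra $\mathcal{K}(1)$ of contact polynomial vector fields (those preserving the distribution singled out by $\alpha=dx+\theta d\theta$) is spanned by $X_F=F\partial_x-\frac12(-1)^{p(F)}\overline\eta(F)\overline\eta$, $F\in\mathbb{K}[x,\theta]$, with $[X_F,X_G]=X_{\{F,G\}}$, $\{F,G\}=FG'-F'G-\frac12(-1)^{p(F)}\overline\eta(F)\overline\eta(G)$. Its subalgebra $\mathfrak{osp}(1|2)$ is $\mathrm{Span}(X_1,X_\theta,X_x,X_{x\theta},X_{x^2})$. For $\lambda\in\mathbb{K}$, $\mathfrak{F}_\lambda=\{F\alpha^\lambda\mid F\in\mathbb{K}[x,\theta]\}$ is the $\mathcal{K}(1)$-module with action $\mathfrak{L}^\lambda_{X_F}=X_F+\lambda F'$. $\mathfrak{D}_{\lambda,\mu}$ is the space of linear differential operators $A$, viewed as maps $\mathfrak{F}_\lambda\to\mathfrak{F}_\mu$, $F\alpha^\lambda\mapsto A(F)\alpha^\mu$, with action $X_F\cdot A=\mathfrak{L}^{\lambda,\mu}_{X_F}(A)=\mathfrak{L}^\mu_{X_F}\circ A-(-1)^{p(A)p(F)}A\circ\mathfrak{L}^\lambda_{X_F}$.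 Relative differential cohomology: with $\mathfrak g=\mathcal K(1)$, $\mathfrak h=\mathfrak{osp}(1|2)$, $V=\mathfrak D_{\lambda,\mu}$, the $\mathfrak h$-relative $n$-cochains are $\mathrm{Hom}_{\mathfrak h}(\Lambda^n(\mathfrak g/\mathfrak h);V)$, and only cochains given by differential operators (in the coefficient functions of the vector fields and in the argument of the density) are considered. For $v\in V^{\mathfrak h}$, $\delta v(g)=(-1)^{p(g)p(v)}g\cdot v$; for a 1-cochain $\Upsilon$, $\delta(\Upsilon)(g,h)=(-1)^{p(g)p(\Upsilon)}g\cdot\Upsilon(h)-(-1)^{p(h)(p(g)+p(\Upsilon))}h\cdot\Upsilon(g)-\Upsilon([g,h])$. $\mathrm H^1_{\mathrm{diff}}(\mathfrak g,\mathfrak h;V)=\ker\delta/\mathrm{im}\,\delta$ in degree 1 (even and odd cochains together). The supertransvectant $\mathfrak{J}^{-1,\lambda}_{\frac k2+1}$ is here the $\mathfrak{osp}(1|2)$-invariant linear differential operator $\mathcal{K}(1)\to\mathfrak{D}_{\lambda,\lambda+\frac k2}$ vanishing on $\mathfrak{osp}(1|2)$, which is unique up to a scalar factor. Explicitly, up to normalization: \begin{align*} \Upsilon_{\lambda,\lambda+\frac32}(X_G)(F\alpha^\lambda)&=\overline\eta(G'')F\,\alpha^{\lambda+\frac32},\\ \Upsilon_{\lambda,\lambda+2}(X_G)(F\alpha^\lambda)&=\Big(\tfrac23\lambda G^{(3)}F-(-1)^{p(G)}\overline\eta(G'')\overline\eta(F)\Big)\alpha^{\lambda+2},\\ \Upsilon_{\lambda,\lambda+\frac52}(X_G)(F\alpha^\lambda)&=\Big(2\lambda\overline\eta(G^{(3)})F-3\overline\eta(G'')F'-(-1)^{p(G)}G^{(3)}\overline\eta(F)\Big)\alpha^{\lambda+\frac52},\\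 \Upsilon_{\lambda,\lambda+3}(X_G)(F\alpha^\lambda)&=\Big((-1)^{p(G)}\overline\eta(G'')\overline\eta(F')-\tfrac{2\lambda+1}{3}\big((-1)^{p(G)}\overline\eta(G^{(3)})\overline\eta(F)+G^{(3)}F'\big)+\tfrac{\lambda(2\lambda+1)}{6}G^{(4)}F\Big)\alpha^{\lambda+3},\\ \Upsilon_{\lambda,\lambda+4}(X_G)(F\alpha^\lambda)&=\Big((-1)^{p(G)}\overline\eta(G'')\overline\eta(F'')-\tfrac{2(\lambda+1)}{3}\big(2(-1)^{p(G)}\overline\eta(G^{(3)})\overline\eta(F')+G^{(3)}F''\big)\\ &\quad+\tfrac{(\lambda+1)(2\lambda+1)}{6}\big((-1)^{p(G)}\overline\eta(G^{(4)})\overline\eta(F)+2G^{(4)}F'\big)-\tfrac{\lambda(\lambda+1)(2\lambda+1)}{15}G^{(5)}F\Big)\alpha^{\lambda+4}. \end{align*} *)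

(* Defs.v *)
From HB Require Import structures.
From mathcomp Require Import all_boot all_order all_algebra.
From mathcomp Require Import functions reals complex ring.

Set Implicit Arguments.
Unset Strict Implicit.
Unset Printing Implicit Defensive.

Import Order.TTheory GRing.Theory Num.Theory.
Local Open Scope ring_scope.

Inductive ground_field := RealField | ComplexField.

Definition base_field (R : realType) (k : ground_field) : numFieldType :=
  match k with
  | RealField => R : numFieldType
  | ComplexField => R[i] : numFieldType
  end.

Definition of_real (R : realType) (k : ground_field) : R -> base_field R k :=
  match k return R -> base_field R k with
  | RealField => fun a => a
  | ComplexField => fun a => a%:C%C
  end.

(* [SuperPoly f g] is f + theta g, with f, g in K[x]. Since there is a single
   odd variable, the supercommutative product of K[x, theta] is also
   commutative. *)
Record superpoly (K : fieldType) : Type :=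
  SuperPoly { body : {poly K}; soul : {poly K} }.
Arguments SuperPoly {K}.

Section SuperpolyAlgebra.
Variable K : fieldType.
Local Notation V := (superpoly K).

Definition pair_of_superpoly (F : V) := (body F, soul F).
Definition superpoly_of_pair (fg : {poly K} * {poly K}) : V :=
  SuperPoly fg.1 fg.2.

Fact pair_of_superpolyK : cancel pair_of_superpoly superpoly_of_pair.
Proof. by case. Qed.

HB.instance Definition _ := Choice.copy V (can_type pair_of_superpolyK).

Definition superpoly_zero : V := SuperPoly 0 0.
Definition superpoly_opp (F : V) : V := SuperPoly (- body F) (- soul F).
Definition superpoly_add (F G : V) : V :=
  SuperPoly (body F + body G) (soul F + soul G).
Definition superpoly_scale (a : K) (F : V) : V :=
  SuperPoly (a *: body F) (a *: soul F).
Definition superpoly_one : V := SuperPoly 1 0.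
Definition superpoly_mul (F G : V) : V :=
  SuperPoly (body F * body G) (body F * soul G + soul F * body G).

Fact superpoly_addA : associative superpoly_add.
Proof. by move=> F G H; congr SuperPoly; rewrite /= addrA. Qed.

Fact superpoly_addC : commutative superpoly_add.
Proof. by move=> F G; congr SuperPoly; rewrite /= addrC. Qed.

Fact superpoly_add0 : left_id superpoly_zero superpoly_add.
Proof. by case=> f g; congr SuperPoly; rewrite /= add0r. Qed.

Fact superpoly_addN : left_inverse superpoly_zero superpoly_opp superpoly_add.
Proof. by move=> F; congr SuperPoly; rewrite /= addNr. Qed.

HB.instance Definition _ := GRing.isZmodule.Build V
  superpoly_addA superpoly_addC superpoly_add0 superpoly_addN.

Fact superpoly_mulA : associative superpoly_mul.
Proof.
by move=> F G H; congr SuperPoly; rewrite /= ?mulrDr ?mulrDl !mulrA ?addrA.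
Qed.

Fact superpoly_mulC : commutative superpoly_mul.
Proof.
move=> F G; congr SuperPoly; first by rewrite mulrC.
by rewrite addrC mulrC (mulrC (body F)).
Qed.

Fact superpoly_mul1 : left_id superpoly_one superpoly_mul.
Proof. by case=> f g; congr SuperPoly; rewrite /= !mul1r ?mul0r ?addr0. Qed.

Fact superpoly_mulD : left_distributive superpoly_mul +%R.
Proof.
by move=> F G H; congr SuperPoly; rewrite /= !mulrDl // addrACA.
Qed.

Fact superpoly_one_neq0 : superpoly_one != 0.
Proof. by apply/eqP => -[/eqP]; rewrite oner_eq0. Qed.

HB.instance Definition _ := GRing.Zmodule_isComNzRing.Build V
  superpoly_mulA superpoly_mulC superpoly_mul1 superpoly_mulD
  superpoly_one_neq0.

Fact superpoly_scaleA (a b : K) (F : V) :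
  superpoly_scale a (superpoly_scale b F) = superpoly_scale (a * b) F.
Proof. by congr SuperPoly; rewrite /= scalerA. Qed.

Fact superpoly_scale1 : left_id 1 superpoly_scale.
Proof. by case=> f g; congr SuperPoly; rewrite /= scale1r. Qed.

Fact superpoly_scaleDr : right_distributive superpoly_scale +%R.
Proof. by move=> a F G; congr SuperPoly; rewrite /= scalerDr. Qed.

Fact superpoly_scaleDl (F : V) :
  {morph superpoly_scale^~ F : a b / a + b}.
Proof. by move=> a b; congr SuperPoly; rewrite /= scalerDl. Qed.

HB.instance Definition _ := GRing.Zmodule_isLmodule.Build K V
  superpoly_scaleA superpoly_scale1 superpoly_scaleDr superpoly_scaleDl.

Fact superpoly_scaleAl (a : K) (F G : V) : a *: (F * G) = (a *: F) * G.
Proof. by congr SuperPoly; rewrite /= ?scalerDr !scalerAl. Qed.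

HB.instance Definition _ :=
  GRing.Lmodule_isLalgebra.Build K V superpoly_scaleAl.

End SuperpolyAlgebra.

Section SuperCalculus.
Variable K : fieldType.
Local Notation V := (superpoly K).

Definition xvar : V := SuperPoly 'X 0.
Definition theta : V := SuperPoly 0 1.

Definition dx (F : V) : V := SuperPoly (body F)^`() (soul F)^`().
Definition dtheta (F : V) : V := SuperPoly (soul F) 0.
Definition etabar (F : V) : V := dtheta F - theta * dx F.

(* Parities are booleans, [true] being odd; 0 has both parities. *)
Definition has_parity (p : bool) (F : V) : Prop :=
  if p then body F = 0 else soul F = 0.

(* The linear map F |-> (-1)^p(F) F. Signs (-1)^p(F) in expressions linear in F
   are written with it, so that these also make sense for inhomogeneous F. *)
Definition psign (F : V) : V := SuperPoly (body F) (- soul F).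

Definition contact_field (F G : V) : V :=
  F * dx G - 2^-1 *: (etabar (psign F) * etabar G).

Definition contact_bracket (F G : V) : V :=
  F * dx G - dx F * G - 2^-1 *: (etabar (psign F) * etabar G).

(* By this lemma and the next one, F |-> X_F identifies K(1) with
   K[x, theta] endowed with the contact bracket; below, elements of K(1) are
   given by their generating functions. *)
Lemma contact_field_inj : injective contact_field.
Proof.
have FE F : contact_field F xvar + contact_field F theta * theta = F.
  case: F => f g; rewrite /contact_field /etabar; congr SuperPoly => /=.
    rewrite -!mul_polyC !derivE. ring.
  rewrite -!mul_polyC !derivE. ring.
by move=> F G eqFG; rewrite -(FE F) -(FE G) eqFG.
Qed.

Lemma contact_field_bracket (p q : bool) (F G H : V) :
  2 != 0 :> K -> has_parity p F -> has_parity q G ->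
  contact_field F (contact_field G H)
    - (-1) ^+ (p && q) *: contact_field G (contact_field F H)
  = contact_field (contact_bracket F G) H.
Proof.
move=> nz2; have /(congr1 (@polyC K)) : 2 * 2^-1 - 1 = 0 :> K by rewrite mulfV ?subrr.
rewrite /contact_field /contact_bracket; move: 2^-1 => c.
rewrite polyCB polyCM => c1.
have half z x y : x = y + (2%:P * c%:P - 1%:P) * z -> x = y.
  by rewrite c1 mul0r addr0.
case: F G H p q => [f0 f1] [g0 g1] [h0 h1] [] [] /= -> ->;
  congr SuperPoly; rewrite /= -!mul_polyC ?derivE ?polyCN; try ring.
- by apply: (half (- c%:P * f1 * g1 * h0^`())); ring.
- apply: (half (- c%:P * ((f1^`() * g1 + f1 * g1^`()) * h1
                         + f1 * g1 * h1^`()))).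
  by ring.
- by apply: (half (c%:P * f1 * g0^`() * h1)); ring.
- by apply: (half (- c%:P * g1 * f0^`() * h1)); ring.
Qed.


Definition in_osp (G : V) : Prop :=
  exists a b c d e : K,
    G = a *: 1 + b *: theta + c *: xvar + d *: (xvar * theta)
        + e *: (xvar ^+ 2).

(* The density F alpha^lambda is represented by F. *)
Definition lie_density (lambda : K) (F G : V) : V :=
  contact_field F G + lambda *: (dx F * G).

Definition dmonomial (i : nat) (e : bool) (F : V) : V :=
  iter i dx (if e then dtheta F else F).

Definition is_diffop (A : V -> V) : Prop :=
  exists (n : nat) (a : nat -> bool -> V), forall F,
    A F = \sum_(i < n) \sum_(e : bool) a i e * dmonomial i e F.

Definition is_bidiffop (c : V -> V -> V) : Prop :=
  exists (n : nat) (a : nat -> bool -> nat -> bool -> V), forall G F,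
    c G F = \sum_(i < n) \sum_(d : bool) \sum_(j < n) \sum_(e : bool)
              a i d j e * (dmonomial i d G * dmonomial j e F).

Definition op_has_parity (p : bool) (A : V -> V) : Prop :=
  forall (q : bool) (F : V), has_parity q F -> has_parity (p (+) q) (A F).

Definition cochain_has_parity (p : bool) (c : V -> V -> V) : Prop :=
  forall (q : bool) (G : V), has_parity q G -> op_has_parity (p (+) q) (c G).

(* X_F . A for F of parity q and A of parity p *)
Definition diffop_act (lambda mu : K) (q p : bool) (F : V) (A : V -> V)
    : V -> V :=
  fun H => lie_density mu F (A H) - (-1) ^+ (p && q) *: A (lie_density lambda F H).

End SuperCalculus.

Section Cohomology.
Variables (K : fieldType) (lambda mu : K).
Local Notation V := (superpoly K).
Local Notation act := (diffop_act lambda mu).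

Definition rel_cochain0 (p : bool) (v : V -> V) : Prop :=
  [/\ is_diffop v, op_has_parity p v &
      forall (a : bool) (X : V), in_osp X -> has_parity a X ->
        act a p X v = 0].

(* Hom_h(g/h, V): the maps vanishing on h and intertwining the actions of h *)
Definition rel_cochain1 (p : bool) (c : V -> V -> V) : Prop :=
  [/\ is_bidiffop c, cochain_has_parity p c,
      forall X, in_osp X -> c X = 0 &
      forall (a b : bool) (X G : V),
        in_osp X -> has_parity a X -> has_parity b G ->
        c (contact_bracket X G) = (-1) ^+ (a && p) *: act a (p (+) b) X (c G)].

Definition rel_cocycle1 (p : bool) (c : V -> V -> V) : Prop :=
  rel_cochain1 p c /\
  forall (a b : bool) (G H : V), has_parity a G -> has_parity b H ->
    (-1) ^+ (a && p) *: act a (p (+) b) G (c H)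
      - (-1) ^+ (b && (a (+) p)) *: act b (p (+) a) H (c G)
      - c (contact_bracket G H) = 0.

Definition rel_coboundary1 (p : bool) (c : V -> V -> V) : Prop :=
  rel_cochain1 p c /\
  exists v, rel_cochain0 p v /\
    forall (a : bool) (G : V), has_parity a G ->
      c G = (-1) ^+ (a && p) *: act a p G v.

Definition even_odd_sum (P : bool -> (V -> V -> V) -> Prop) (c : V -> V -> V)
    : Prop :=
  exists c0 c1, [/\ P false c0, P true c1 & c = c0 + c1].

Definition C1 := even_odd_sum rel_cochain1.
Definition Z1 := even_odd_sum rel_cocycle1.
Definition B1 := even_odd_sum rel_coboundary1.

End Cohomology.

Section QuotientDimension.
Variables (K : fieldType) (W : lmodType K).

Definition spans_quotient (Z B : W -> Prop) (n : nat) (e : 'I_n -> W) : Prop :=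
  (forall i, Z (e i)) /\
  forall z, Z z -> exists a : 'I_n -> K, B (z - \sum_(i < n) a i *: e i).

Definition basis_of_quotient (Z B : W -> Prop) (n : nat) (e : 'I_n -> W)
    : Prop :=
  spans_quotient Z B e /\
  forall a : 'I_n -> K, B (\sum_(i < n) a i *: e i) -> forall i, a i = 0.

Definition quotient_dim (Z B : W -> Prop) (n : nat) : Prop :=
  exists e : 'I_n -> W, basis_of_quotient Z B e.

End QuotientDimension.

Definition H1_dim (K : fieldType) (lambda mu : K) (n : nat) : Prop :=
  quotient_dim (Z1 lambda mu) (B1 lambda mu) n.

Definition H1_spanned_by (K : fieldType) (lambda mu : K)
    (c : superpoly K -> superpoly K -> superpoly K) : Prop :=
  spans_quotient (Z1 lambda mu) (B1 lambda mu) (fun _ : 'I_1 => c).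

(* J^{-1,lambda}_{k/2+1}, which is determined up to a base_field factor *)
Definition is_supertransvectant (K : fieldType) (lambda : K) (k : nat)
    (J : superpoly K -> superpoly K -> superpoly K) : Prop :=
  [/\ C1 lambda (lambda + k%:R / 2) J, J <> 0 &
      forall J', C1 lambda (lambda + k%:R / 2) J' -> exists a : K, J' = a *: J].

(* Only k = 3, 4, 5, 6, 8 are meaningful. *)
Definition Upsilon (K : fieldType) (lambda : K) (k : nat) (G F : superpoly K)
    : superpoly K :=
  let eb := @etabar K in
  let d i H := iter i (@dx K) H in
  let sG := psign G in
  match k with
  | 3%N => eb (d 2 G) * F
  | 4%N => (2 / 3 * lambda) *: (d 3 G * F) - eb (d 2 sG) * eb F
  | 5%N => (2 * lambda) *: (eb (d 3 G) * F) - 3 *: (eb (d 2 G) * d 1 F)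
         - d 3 sG * eb F
  | 6%N => eb (d 2 sG) * eb (d 1 F)
         - ((2 * lambda + 1) / 3) *:
             (eb (d 3 sG) * eb F + d 3 G * d 1 F)
         + (lambda * (2 * lambda + 1) / 6) *: (d 4 G * F)
  | 8%N => eb (d 2 sG) * eb (d 2 F)
         - (2 * (lambda + 1) / 3) *:
             (2 *: (eb (d 3 sG) * eb (d 1 F)) + d 3 G * d 2 F)
         + ((lambda + 1) * (2 * lambda + 1) / 6) *:
             (eb (d 4 sG) * eb F + 2 *: (d 4 G * d 1 F))
         - (lambda * (lambda + 1) * (2 * lambda + 1) / 15) *: (d 5 G * F)
  | _ => 0
  end.

(* Main.v *)
(** Write [eta = dtheta + theta dx], so that [X_theta] acts as [eta / 2] on all
densities and [eta ^ 2 = dx].  A family of superpolynomials that [eta] maps into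
its own span vanishes as soon as all its bodies vanish at the origin.  Hence a
relative cochain [c] is determined by the numbers [phi a b], the body at the
origin of [c (e_a) (e_b)], where [e_(2i)] is [x^i] and [e_(2i+1)] is
[x^i theta].  Equivariance under [X_x] says that [phi a b] is nonzero only if
[a + b = k + 2], where [mu = lambda + k / 2]; equivariance under [X_(x theta)]
is a recursion which determines all [phi a b] from [phi 5 (k - 3)].  So
cochains form a line if [k >= 3] and vanish otherwise.

In the same way the differential of [c] is determined by its values at the
origin on [(e_a, e_b, e_d)], which vanish unless [a, b >= 5] and
[a + b + d = k + 4].  There is no such triple for [k <= 5].  For odd [k >= 7]
the triple [(5, 5, k - 6)] forces [lambda = - (k - 1) / 4], where the cocycle is
the coboundary of [etabar ^ k]; for even [k] the triples [(5, 5, k - 6)] and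
[(5, 9, k - 10)] leave only [k = 6] and [k = 8].  The only relative 0-cochains
with [k >= 3] are the multiples of [etabar ^ k] for odd [k] and
[lambda = - (k - 1) / 4]. *)

From HB Require Import structures.
Require Import Defs.
From mathcomp Require Import all_boot all_order all_algebra.
From mathcomp Require Import boolp functions reals complex ring zify.

Set Implicit Arguments.
Unset Strict Implicit.
Unset Printing Implicit Defensive.

Import GRing.Theory Num.Theory.
Local Open Scope ring_scope.

(** * Polynomial identities involving derivatives *)

Ltac expand_deriv := repeat match goal with
 | |- context [deriv (?a + ?b)] => rewrite (derivD a b)
 | |- context [deriv (- ?a)] => rewrite (derivN a)
 | |- context [deriv (?a * ?b)] => rewrite (derivM a b)
 | |- context [deriv (?a *: ?b)] => rewrite (derivZ a b)
 | |- context [deriv (?a *+ ?n)] => rewrite (derivMn n a)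
 | |- context [deriv 'X] => rewrite derivX
 | |- context [deriv 0] => rewrite deriv0
 | |- context [deriv 1] => rewrite derivC
 | |- context [deriv (?a%:P)] => rewrite (derivC a)
end.

Ltac generalize_deriv := repeat match goal with
 | |- context [deriv ?a] =>
     is_var a; let d := fresh "d" in set d := deriv a; clearbody d
end.

Ltac generalize_polyC := repeat match goal with
 | |- context [@polyC ?R (1 *+ ?n)] => rewrite (polyC_natr R n)
 | |- context [@polyC ?R ?a] => generalize (@polyC R a); intro
end.

(** Once derivatives are pushed down to variables, these derivatives and the constant polynomials
    become indeterminates, and an identity in a commutative ring remains. *)
Ltac poly_ring :=
  rewrite -?mul_polyC; expand_deriv;
  generalize_deriv; generalize_polyC; ring.

(** * Lie derivatives of densities *)

(* Locked: otherwise unification unfolds it when rewriting with additivity. *)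
HB.lock Definition lie (K : numFieldType) (lambda : K) (F G : superpoly K) :
  superpoly K := lie_density lambda F G.

Lemma lie_densityE (K : numFieldType) (lambda : K) (F G : superpoly K) :
  lie_density lambda F G = lie lambda F G.
Proof. by rewrite lie.unlock. Qed.

Section Calculus.
Variable K : numFieldType.
Local Notation V := (superpoly K).
Implicit Types (F G H X : V) (lambda mu : K).

Lemma superpoly_eq F G : body F = body G -> soul F = soul G -> F = G.
Proof. by case: F => f0 f1; case: G => g0 g1 /= -> ->. Qed.

Lemma etabarE F : etabar F = SuperPoly (soul F) (- (body F)^`()).
Proof.
by apply: superpoly_eq; rewrite /= ?mul0r ?mul1r ?add0r ?oppr0 ?addr0.
Qed.

Definition eta F : V := SuperPoly (soul F) (body F)^`().

Fact eta_linear : linear eta.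
Proof.
by move=> a F G; apply: superpoly_eq => //=; rewrite derivD derivZ.
Qed.
HB.instance Definition _ := GRing.isLinear.Build K V V *:%R eta eta_linear.

Fact psign_linear : linear (@psign K).
Proof.
by move=> a F G; apply: superpoly_eq => //=; rewrite opprD scalerN.
Qed.
HB.instance Definition _ :=
  GRing.isLinear.Build K V V *:%R (@psign K) psign_linear.

Lemma etaD F G : eta (F + G) = eta F + eta G. Proof. exact: linearD. Qed.
Lemma etaN F : eta (- F) = - eta F. Proof. exact: linearN. Qed.
Lemma etaZ a F : eta (a *: F) = a *: eta F. Proof. exact: linearZ. Qed.
Lemma psignD F G : psign (F + G) = psign F + psign G. Proof. exact: linearD. Qed.
Lemma psignZ a F : psign (a *: F) = a *: psign F. Proof. exact: linearZ. Qed.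

Lemma psignK F : psign (psign F) = F.
Proof. by apply: superpoly_eq => //=; rewrite opprK. Qed.

Lemma eta_psign F : eta (psign F) = - psign (eta F).
Proof. by apply: superpoly_eq => //=; rewrite opprK. Qed.

Lemma eta_eta F : eta (eta F) = dx F.
Proof. by []. Qed.

Lemma psign_parity a F : has_parity a F -> psign F = (-1) ^+ a *: F.
Proof.
case: F a => [f0 f1] [] /= ->; rewrite ?expr1 ?expr0 ?scaleN1r ?scale1r.
  by apply: superpoly_eq; rewrite /= ?oppr0.
by apply: superpoly_eq; rewrite /= ?oppr0.
Qed.

(* With 2^-1 factored out, both sides of the identities below are homogeneous in
   it, so that [ring] can treat it as an indeterminate. *)
Lemma lieE mu F G : lie mu F G = 2^-1 *: SuperPoly
  (2 * (body F * (body G)^`()) + soul F * soul G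
     + mu *: (2 * ((body F)^`() * body G)))
  (2 * (body F * (soul G)^`()) + soul F * (body G)^`()
     + (body F)^`() * soul G
     + mu *: (2 * ((body F)^`() * soul G + (soul F)^`() * body G))).
Proof.
have h2 : 2 * (2^-1)%:P = 1 :> {poly K}.
  by rewrite -[2]/((2%:R : {poly K})) -(polyC_natr K 2) -polyCM mulfV ?pnatr_eq0.
(* [ring] does not know that [2 * 2^-1 = 1], so each identity is proved up to an explicit multiple
   [z] of [1 - 2 * (2^-1)%:P]. *)
have half (z x y : {poly K}) : x = y + (1 - 2 * (2^-1)%:P) * z -> x = y.
  by rewrite h2 subrr mul0r addr0.
rewrite lie.unlock /lie_density /contact_field !etabarE.
case: F G => [f0 f1] [g0 g1]; apply: superpoly_eq => /=;
  rewrite -!mul_polyC; move: (mu%:P) (2^-1%:P) half => {h2} m h half;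
  expand_deriv; generalize_deriv.
  by apply: (half (f0 * d + m * (d0 * g0))); ring.
by apply: (half (f0 * d + f1 * d0 + m * (d1 * g1 + d2 * g0))); ring.
Qed.

(** The adjoint module is the module of densities of weight -1, so facts about [lie] cover the
    bracket as well. *)
Lemma contact_bracketE F G : contact_bracket F G = lie (-1) F G.
Proof. by rewrite lie.unlock /contact_bracket /lie_density /contact_field
  scaleN1r addrAC. Qed.

Fact lie_linear mu F : linear (lie mu F).
Proof.
move=> a G H; rewrite !lieE; apply: superpoly_eq => /=; poly_ring.
Qed.
HB.instance Definition _ mu F :=
  GRing.isLinear.Build K V V *:%R (lie mu F) (lie_linear mu F).

Lemma lieDr mu F G H :
  lie mu F (G + H) = lie mu F G + lie mu F H.
Proof. exact: linearD. Qed.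

Lemma lieNr mu F G : lie mu F (- G) = - lie mu F G.
Proof. exact: linearN. Qed.

Lemma lieZr mu a F G :
  lie mu F (a *: G) = a *: lie mu F G.
Proof. exact: linearZ. Qed.

Lemma lieDl mu F G H :
  lie mu (F + G) H = lie mu F H + lie mu G H.
Proof. rewrite !lieE; apply: superpoly_eq => /=; poly_ring. Qed.

Lemma lieZl mu a F H : lie mu (a *: F) H = a *: lie mu F H.
Proof. rewrite !lieE; apply: superpoly_eq => /=; poly_ring. Qed.

Lemma lieNl mu F H : lie mu (- F) H = - lie mu F H.
Proof. by rewrite -scaleN1r lieZl scaleN1r. Qed.

(** This is the module axiom for [X_theta]: [eta] is twice its action on densities of every weight,
    including weight -1 for [F]. The sign for moving [eta] past [F] is carried by [psign]. *)
Lemma eta_lie mu F G :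
  eta (lie mu F G) = lie mu (eta F) G + lie mu (psign F) (eta G).
Proof.
case: F G => [f0 f1] [g0 g1]; rewrite !lieE; apply: superpoly_eq => /=; poly_ring.
Qed.

Lemma psign_lie mu F G :
  psign (lie mu F G) = lie mu (psign F) (psign G).
Proof. rewrite !lieE; apply: superpoly_eq => /=; poly_ring. Qed.

Lemma lie_theta mu F : lie mu (theta K) F = 2^-1 *: eta F.
Proof. rewrite !lieE; apply: superpoly_eq => /=; poly_ring. Qed.

Lemma lie_one mu F : lie mu 1 F = dx F.
Proof.
rewrite lie.unlock /lie_density /contact_field !etabarE.
by apply: superpoly_eq => /=; poly_ring.
Qed.

Lemma xthetaE : xvar K * theta K = SuperPoly 0 'X.
Proof. by apply: superpoly_eq; rewrite /= ?mulr0 ?mulr1 ?mul0r ?addr0. Qed.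

Lemma eta_x : eta (xvar K) = theta K.
Proof. by apply: superpoly_eq; rewrite /= ?derivX. Qed.

Lemma eta_xtheta : eta (xvar K * theta K) = xvar K.
Proof. by rewrite xthetaE; apply: superpoly_eq; rewrite /= ?deriv0. Qed.

Lemma psign_x : psign (xvar K) = xvar K.
Proof. by apply: superpoly_eq; rewrite /= ?oppr0. Qed.

Lemma psign_xtheta : psign (xvar K * theta K) = - (xvar K * theta K).
Proof. by rewrite xthetaE; apply: superpoly_eq; rewrite /= ?oppr0. Qed.

Lemma lie_x_sqr mu F : lie mu (xvar K ^+ 2) F =
  SuperPoly ('X * 'X * (body F)^`() + mu *: (2 * ('X * body F)))
            ('X * 'X * (soul F)^`() + 'X * soul F + mu *: (2 * ('X * soul F))).
Proof.
have halfK (W : V) : W = 2^-1 *: (2 *: W).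
  by rewrite scalerA mulVf ?pnatr_eq0 // scale1r.
rewrite lieE [RHS]halfK; congr (_ *: _).
apply: superpoly_eq => /=; poly_ring.
Qed.

(** The square of an odd operator is half its bracket with itself. Through this identity [X_(x ^ 2)]
    never has to be treated on its own. *)
Lemma lie_xtheta_sqr mu F :
  lie mu (xvar K * theta K) (lie mu (xvar K * theta K) F)
  = (2^-1 * 2^-1) *: lie mu (xvar K ^+ 2) F.
Proof.
rewrite lie_x_sqr.
rewrite -scalerA xthetaE !lieE; apply: superpoly_eq => /=; poly_ring.
Qed.

Lemma bracket_skew a b F G : has_parity a F -> has_parity b G ->
  lie (-1) F G = - (-1) ^+ (a && b) *: lie (-1) G F.
Proof.
rewrite !lieE; case: F G a b => [f0 f1] [g0 g1] [] [] /= -> ->;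
  rewrite ?expr0 ?expr1 ?opprK ?scale1r ?scaleN1r; apply: superpoly_eq => /=;
    poly_ring.
Qed.

End Calculus.

Arguments eta {K}.

(** * Taylor coefficients and the action of eta *)

Section Taylor.
Variable K : numFieldType.
Local Notation V := (superpoly K).
Implicit Types (F G H X : V) (lambda mu : K).

Definition ev F : K := (body F)`_0.

Fact ev_linear : linear_for *%R ev.
Proof. by move=> a F G; rewrite /ev /= coefD coefZ. Qed.
HB.instance Definition _ := GRing.isLinear.Build K V K *%R ev ev_linear.

Lemma evD F G : ev (F + G) = ev F + ev G. Proof. exact: linearD. Qed.
Lemma evN F : ev (- F) = - ev F. Proof. exact: linearN. Qed.
Lemma evZ a F : ev (a *: F) = a * ev F. Proof. exact: linearZ. Qed.

Lemma body_iter_eta n F :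
  (body (iter n.*2 eta F) = (body F)^`(n)) * (soul (iter n.*2 eta F) = (soul
    F)^`(n)).
Proof.
elim: n => [|n [IHb IHs]]; first by rewrite !derivn0.
by rewrite doubleS !iterS /= IHb IHs.
Qed.

(** Even iterates of [eta] read off the Taylor coefficients of the body and odd ones those of the
    soul, up to factorials, which are nonzero in characteristic 0. *)
Lemma eq0_of_jets F : (forall n, ev (iter n eta F) = 0) -> F = 0.
Proof.
move=> F0; apply: superpoly_eq; apply/polyP => n; rewrite coef0.
  move: (F0 n.*2); rewrite /ev body_iter_eta coef_derivn addn0 => /eqP.
  by rewrite mulrn_eq0 ffactnn eqn0Ngt fact_gt0 => /eqP.
move: (F0 n.*2.+1); rewrite /ev iterS /= body_iter_eta coef_derivn addn0 => /eqP.
by rewrite mulrn_eq0 ffactnn eqn0Ngt fact_gt0 => /eqP.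
Qed.

(** Induction on the order, for all indices at once: a jet of order n + 1 of a member is a
    combination of jets of order n of other members. In the applications, [I] collects all arguments
    of a multilinear expression. *)
Lemma eta_stable_eq0 (I : Type) (M : I -> V) :
  (forall i, exists r : seq (K * I), eta (M i) = \sum_(x <- r) x.1 *: M x.2) ->
  (forall i, ev (M i) = 0) -> forall i, M i = 0.
Proof.
move=> stable ev0 i; apply: eq0_of_jets => n.
elim: n i => [//|n IHn] i.
have iterD (m : nat) : forall r : seq (K * I), iter m eta (\sum_(x <- r) x.1 *: M
  x.2)
    = \sum_(x <- r) x.1 *: iter m eta (M x.2).
  by elim: m => [//|m IHm] r; rewrite iterS IHm linear_sum; apply: eq_bigr => x _;
    rewrite linearZ.
have [r rE] := stable i; rewrite iterSr rE iterD linear_sum big1 // => x _.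
by rewrite linearZ /= IHn mulr0.
Qed.

(* x ^ i for n = 2 i, and x ^ i theta for n = 2 i + 1; X_1, X_theta, X_x,
   X_(x theta) and X_(x ^ 2) are mono 0, ..., mono 4. *)
Definition mono (n : nat) : V :=
  if odd n then SuperPoly 0 'X^(n./2) else SuperPoly 'X^(n./2) 0.

Lemma superpoly_mono_ind (P : V -> Prop) :
  (forall F G, P F -> P G -> P (F + G)) -> (forall a F, P F -> P (a *: F)) ->
  (forall n, P (mono n)) -> forall F, P F.
Proof.
move=> PD PZ Pm [f g].
have P0 : P 0 by rewrite -(scale0r (mono 0)); apply: PZ.
have Psum (n : nat) (h : 'I_n -> V) : (forall i, P (h i)) -> P (\sum_(i < n) h i).
  by move=> Ph; elim/big_ind: _ => //; exact: PD.
have -> : SuperPoly f g = \sum_(i < size f) f`_i *: mono i.*2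
                        + \sum_(i < size g) g`_i *: mono i.*2.+1.
  have bodyD (n : nat) (h : 'I_n -> V) : body (\sum_(i < n) h i) = \sum_(i < n)
    body (h i).
    by elim/big_rec2: _ => // i y x _ <-.
  have soulD (n : nat) (h : 'I_n -> V) : soul (\sum_(i < n) h i) = \sum_(i < n)
    soul (h i).
    by elim/big_rec2: _ => // i y x _ <-.
  apply: superpoly_eq; rewrite /= ?(bodyD, soulD).
    rewrite -[LHS]coefK poly_def [X in _ = _ + X]big1 ?addr0 => [|i _].
      by apply: eq_bigr => i _; rewrite /mono odd_double doubleK.
    by rewrite /mono /= odd_double /= scaler0.
  rewrite -[LHS]coefK poly_def [X in _ = X + _]big1 ?add0r => [|i _].
    by apply: eq_bigr => i _; rewrite /mono /= odd_double /= uphalf_double.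
  by rewrite /mono odd_double /= scaler0.
apply: PD; apply: Psum => i; exact: PZ.
Qed.

Lemma mono0 : mono 0 = 1. Proof. by apply: superpoly_eq; rewrite /= ?expr0. Qed.
Lemma mono1 : mono 1 = theta K. Proof. by apply: superpoly_eq;
  rewrite /= ?expr0. Qed.
Lemma mono2 : mono 2 = xvar K. Proof. by apply: superpoly_eq;
  rewrite /= ?expr1. Qed.
Lemma mono3 : mono 3 = xvar K * theta K.
Proof. by rewrite xthetaE; apply: superpoly_eq; rewrite /= ?expr1. Qed.
Lemma mono4 : mono 4 = xvar K ^+ 2.
Proof. by apply: superpoly_eq; rewrite /= ?expr2 ?mulr0 ?mul0r ?addr0. Qed.

Lemma in_osp_mono n : (n < 5)%N -> in_osp (mono n).
Proof.
case: n => [|[|[|[|[|//]]]]] _; rewrite ?mono0 ?mono1 ?mono2 ?mono3 ?mono4.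
- by exists 1, 0, 0, 0, 0; rewrite scale1r !scale0r !addr0.
- by exists 0, 1, 0, 0, 0; rewrite scale1r !scale0r !addr0 add0r.
- by exists 0, 0, 1, 0, 0; rewrite scale1r !scale0r !addr0 !add0r.
- by exists 0, 0, 0, 1, 0; rewrite scale1r !scale0r !addr0 !add0r.
- by exists 0, 0, 0, 0, 1; rewrite scale1r !scale0r !add0r.
Qed.

Lemma mono_parity n : has_parity (odd n) (mono n).
Proof. by rewrite /mono /has_parity; case: (odd n). Qed.

Lemma psign_mono n : psign (mono n) = (-1) ^+ n *: mono n.
Proof. by rewrite (psign_parity (mono_parity n)) signr_odd. Qed.

Lemma ev_mono n : ev (mono n) = (n == 0)%:R.
Proof.
rewrite /ev /mono; case: n => [|[|n]] //=; rewrite ?coef0 ?coef1 //.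
by rewrite negbK; case: (odd n); rewrite /= ?coef0 // coefXn.
Qed.

Definition lie_coef lambda (a b : nat) : K :=
  if odd a then if odd b then 2^-1 else b./2%:R / 2 + lambda * a./2%:R
  else if odd b then b./2%:R + lambda * a./2%:R + a./2%:R / 2
  else b./2%:R + lambda * a./2%:R.

(* If a + b < 2 then the coefficient is 0: the truncated subtraction is
   harmless. *)
Lemma lie_mono lambda a b :
  lie lambda (mono a) (mono b) = lie_coef lambda a b *: mono (a + b - 2).
Proof.
have dX i l : ('X^i : {poly K}) * ('X^l)^`() = l%:R *: 'X^(i + l - 1).
  case: l => [|l]; first by rewrite derivC mulr0 scale0r.
  by rewrite derivXn -scaler_nat -scalerAr -exprD addnS subn1.
have Xd i l : ('X^i : {poly K})^`() * 'X^l = i%:R *: 'X^(i + l - 1).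
  by rewrite mulrC dX addnC.
have muln2 (p : {poly K}) : 2 * p = 2 *: p by rewrite scaler_nat mulr_natl.
have c2 : 2^-1 * 2 = 1 :> K by rewrite mulVf ?pnatr_eq0.
rewrite lieE /lie_coef /mono -(odd_double_half a) -(odd_double_half b).
move: (a./2) (b./2) => i l; rewrite !oddD !odd_double !addbF !oddb.
rewrite !half_bit_double.
pose zE := (mul0r, mulr0, deriv0, derivC, add0r, addr0, scaler0, scale0r).
case: (odd a) (odd b) => [] [] /=.
- have -> : (1 + i.*2 + (1 + l.*2) - 2 = (i + l).*2)%N by lia.
  by rewrite odd_double doubleK; apply: superpoly_eq; rewrite /= !zE ?exprD.
- case: (posnP (i + l)) => [/eqP|il].
    rewrite addn_eq0 => /andP[/eqP-> /eqP->] /=.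
    by apply: superpoly_eq; rewrite /= !zE.
  have -> : (1 + i.*2 + (0 + l.*2) - 2 = (i + l - 1).*2.+1)%N by lia.
  rewrite /= odd_double uphalf_double; apply: superpoly_eq; rewrite /= !zE //.
  rewrite dX Xd muln2 !scalerA -scalerDl scalerA.
  by congr (_ *: _); field.
- case: (posnP (i + l)) => [/eqP|il].
    rewrite addn_eq0 => /andP[/eqP-> /eqP->] /=.
    by apply: superpoly_eq; rewrite /= !zE.
  have -> : (0 + i.*2 + (1 + l.*2) - 2 = (i + l - 1).*2.+1)%N by lia.
  rewrite /= odd_double uphalf_double; apply: superpoly_eq; rewrite /= !zE //.
  rewrite dX Xd !muln2 !scalerA -!scalerDl scalerA.
  by congr (_ *: _); field.
have -> : (0 + i.*2 + (0 + l.*2) - 2 = (i + l - 1).*2)%N by lia.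
rewrite odd_double doubleK; apply: superpoly_eq; rewrite /= !zE //.
rewrite dX Xd !muln2 !scalerA -!scalerDl scalerA.
by congr (_ *: _); field.
Qed.

End Taylor.

(** * Cochains as invariant bilinear maps *)

Section Invariant.
Variable K : numFieldType.
Local Notation V := (superpoly K).
Local Notation x := (xvar K).
Local Notation xtheta := (xvar K * theta K).
Implicit Types (F G H X : V) (lambda mu s : K) (c : V -> V -> V).

(** Up to the factorials of [jet_mono], these are the coordinates dual to the basis [mono]. *)
Definition jet n F : K := ev (iter n eta F).

Lemma jetS n F : jet n.+1 F = jet n (eta F).
Proof. by rewrite /jet iterSr. Qed.

Fact jet_linear n : linear_for *%R (jet n).
Proof.
elim: n => [|n IHn] a F G; first exact: linearP.
by rewrite !jetS linearP IHn.
Qed.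
HB.instance Definition _ n := GRing.isLinear.Build K V K *%R (jet n) (jet_linear n).

Lemma ev_lie lambda F G : ev (lie lambda F G) =
  ev F * jet 2 G + 2^-1 * (jet 1 F * jet 1 G) + lambda * (jet 2 F * ev G).
Proof.
rewrite lieE /jet /ev /= !coefZ !coefD coefZ !mulr_natl !coefMn !coef0M.
by field.
Qed.

Lemma eta_lie_x lambda F :
  eta (lie lambda x F) = 2^-1 *: eta F + lie lambda x (eta F).
Proof. by rewrite eta_lie eta_x lie_theta psign_x. Qed.

Lemma eta_lie_xtheta lambda F : eta (lie lambda xtheta F)
  = lie lambda x F - lie lambda xtheta (eta F).
Proof. by rewrite eta_lie eta_xtheta psign_xtheta lieNl. Qed.

Lemma jet_x n : jet n x = (n == 2)%:R.
Proof.
case: n => [|[|n]]; rewrite ?jetS ?eta_x -?mono1 -?mono2 ?[jet 0 _]ev_mono //.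
have -> : eta (mono K 1) = mono K 0 by rewrite mono0; apply: superpoly_eq;
  rewrite /= ?deriv0 ?expr0.
elim: n => [|n IHn]; first by rewrite [jet 0 _]ev_mono.
rewrite jetS mono0.
have -> : eta (1 : V) = 0 by apply: superpoly_eq; rewrite /= ?derivC.
by rewrite linear0.
Qed.

Lemma ev_lie_x lambda F : ev (lie lambda x F) = lambda * ev F.
Proof. by rewrite ev_lie -[ev x]/(jet 0 x) !jet_x /=; ring. Qed.

Lemma ev_lie_xtheta lambda F : ev (lie lambda xtheta F) = 0.
Proof.
rewrite ev_lie !(jetS _ xtheta) eta_xtheta !jet_x.
have -> : ev xtheta = 0 by rewrite -mono3 ev_mono.
by rewrite /=; ring.
Qed.

Lemma jet_lie_x n lambda F :
  jet n (lie lambda x F) = (n%:R / 2 + lambda) * jet n F.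
Proof.
elim: n F => [|n IHn] F; first by rewrite mul0r add0r; exact: ev_lie_x.
by rewrite !jetS eta_lie_x linearD linearZ /= IHn -[n.+1]addn1 natrD; field.
Qed.

Definition xtheta_coef lambda n : K :=
  n./2%:R / 2 + (if odd n then lambda else 0).

(** Moving one [eta] past the odd field [X_(x theta)] yields [X_x] and a change of sign, so the
    coefficients obey [c (n + 1) = n / 2 + lambda - c n] with [c 0 = 0]. At [n = 0] the truncated
    [n.-1] is multiplied by 0. *)
Lemma jet_lie_xtheta n lambda F :
  jet n (lie lambda xtheta F) = xtheta_coef lambda n * jet n.-1 F.
Proof.
elim: n F => [|n IHn] F.
  by rewrite /xtheta_coef mul0r add0r mul0r; exact: ev_lie_xtheta.
rewrite jetS eta_lie_xtheta linearB /= jet_lie_x IHn.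
have -> : jet n.-1 (eta F) = jet n.-1.+1 F by rewrite jetS.
case: n {IHn} => [|n]; first by rewrite /xtheta_coef /=; field.
rewrite -mulrBl; congr (_ * _).
have -> : (n.+1%:R : K) = (odd n.+1)%:R + n.+1./2%:R * 2.
  by rewrite -{1}(odd_double_half n.+1) natrD -muln2 natrM.
rewrite /xtheta_coef -[n.+2./2]/(uphalf n.+1) uphalf_half natrD.
rewrite -[odd n.+2]/(~~ odd n.+1); move: (odd n.+1) (n.+1./2%:R : K) => o h.
by case: o; rewrite /=; field.
Qed.

(** The cochain axioms speak of homogeneous fields only; this carries their linear consequences over
    to all fields. *)
Lemma homogeneous_ind (P : V -> Prop) :
  (forall F G, P F -> P G -> P (F + G)) ->
  (forall a F, has_parity a F -> P F) -> forall F, P F.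
Proof.
move=> PD Ph [f g].
have -> : SuperPoly f g = SuperPoly f 0 + SuperPoly 0 g.
  by apply: superpoly_eq; rewrite /= ?addr0 ?add0r.
by apply: PD; [apply: (Ph false) | apply: (Ph true)].
Qed.

(* Equivariance under X_x and X_(x theta) is only required at the origin. For X_x,
   X_(x theta) and finally X_(x ^ 2) = 4 X_(x theta)^2, full equivariance then
   follows from that under X_theta, as the defects of equivariance are permuted
   by eta. *)
Record invariant lambda mu s c : Prop := Invariant {
  invariant_linearl : forall F, linear (c^~ F);
  invariant_linearr : forall G, linear (c G);
  invariant_theta : forall G F,
    eta (c G F) = s *: (c (eta G) F + c (psign G) (eta F));
  invariant_osp : forall X F, in_osp X -> c X F = 0;
  invariant_x : forall G F, ev (c (lie (-1) x G) F)
    + ev (c G (lie lambda x F)) = mu * ev (c G F);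
  invariant_xtheta : forall G F, ev (c (lie (-1) xtheta G) F)
    = - ev (c (psign G) (lie lambda xtheta F)) }.

Lemma mulrZ_super k F G : F * (k *: G) = k *: (F * G).
Proof. by rewrite mulrC -scalerAl mulrC. Qed.

Lemma dmonomial_linear i e : linear (@dmonomial K i e).
Proof.
move=> a F G; rewrite /dmonomial.
have -> : (if e then dtheta (a *: F + G) else a *: F + G)
   = a *: (if e then dtheta F else F) + (if e then dtheta G else G).
  by case: e => //; apply: superpoly_eq; rewrite /= ?scaler0 ?addr0.
elim: i => [//|i IHi]; rewrite !iterS IHi.
by apply: superpoly_eq; rewrite /= derivD derivZ.
Qed.

Lemma diffop_linear (A : V -> V) : is_diffop A -> linear A.
Proof.
case=> n [a AE] k F G; rewrite !AE scaler_sumr -big_split; apply: eq_bigr => i _.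
rewrite scaler_sumr -big_split; apply: eq_bigr => e _.
by rewrite /= dmonomial_linear mulrDr mulrZ_super.
Qed.

Lemma bidiffop_linearl c F : is_bidiffop c -> linear (c^~ F).
Proof.
case=> n [a cE] k G H; rewrite !cE scaler_sumr -big_split; apply: eq_bigr => i _.
rewrite scaler_sumr -big_split; apply: eq_bigr => d _.
rewrite scaler_sumr -big_split; apply: eq_bigr => j _.
rewrite scaler_sumr -big_split; apply: eq_bigr => e _.
by rewrite /= dmonomial_linear mulrDl mulrDr -scalerAl mulrZ_super.
Qed.

Lemma bidiffop_linearr c G : is_bidiffop c -> linear (c G).
Proof.
case=> n [a cE] k F H; rewrite !cE scaler_sumr -big_split; apply: eq_bigr => i _.
rewrite scaler_sumr -big_split; apply: eq_bigr => d _.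
rewrite scaler_sumr -big_split; apply: eq_bigr => j _.
rewrite scaler_sumr -big_split; apply: eq_bigr => e _.
by rewrite /= dmonomial_linear !mulrDr !mulrZ_super.
Qed.

Lemma linear_facts (f : V -> V) : linear f ->
  [/\ {morph f : F G / F + G}, {morph f : F / - F}, f 0 = 0 &
      forall a, {morph f : F / a *: F}].
Proof.
move=> fl; have f0 : f 0 = 0.
  by have := fl (-1) 0 0; rewrite scaler0 addr0 scaleN1r addNr.
have fZ a F : f (a *: F) = a *: f F by rewrite -[a *: F]addr0 fl f0 addr0.
split=> //; first by move=> F G; rewrite -[F]scale1r fl !scale1r.
by move=> F; rewrite -scaleN1r fZ scaleN1r.
Qed.

End Invariant.

(** * Relative cochains as invariant maps, and their coefficients at the origin *)

Section Cochains.
Variable K : numFieldType.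
Local Notation V := (superpoly K).
Local Notation x := (xvar K).
Local Notation xtheta := (xvar K * theta K).
Implicit Types (F G H X : V) (lambda mu s : K) (c : V -> V -> V).

Lemma two_scaleI : injective ( *:%R (2^-1 : K) : V -> V).
Proof.
move=> F G /(congr1 ( *:%R (2 : K))); rewrite !scalerA mulfV ?pnatr_eq0 //.
by rewrite !scale1r.
Qed.

Lemma rel_cochain1_act lambda mu p c a b X G F :
  rel_cochain1 lambda mu p c -> in_osp X -> has_parity a X -> has_parity b G ->
  c (lie (-1) X G) F = (-1) ^+ (a && p) *: lie mu X (c G F)
     - (-1) ^+ (a && b) *: c G (lie lambda X F).
Proof.
case=> _ _ _ eqv Xosp aX bG.
have := congr1 (fun f => f F) (eqv a b X G Xosp aX bG).
rewrite contact_bracketE => ->.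
rewrite -[LHS]/((-1) ^+ (a && p) *: diffop_act lambda mu a (p (+) b) X (c G) F).
rewrite /diffop_act lie.unlock scalerBr scalerA -signr_addb; congr (_ - _ *: _).
by clear; case: a p b => [] [] [].
Qed.

(** Equivariance is specialised to [mono 1], [mono 2] and [mono 3]. For the last two it is read at
    the origin, where [X_x] acts on values by [mu] and [X_(x theta)] by 0. *)
Lemma rel_cochain1_invariant lambda mu p c :
  rel_cochain1 lambda mu p c -> invariant lambda mu ((-1) ^+ p) c.
Proof.
move=> cP; have [cdiff _ cosp _] := cP.
have linl F := linear_facts (bidiffop_linearl F cdiff).
have linr G := linear_facts (bidiffop_linearr G cdiff).
have oX n : (n < 5)%N -> in_osp (mono K n) by exact: in_osp_mono.
split=> [F|G|G F|X F /cosp->|G F|G F] //.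
- exact: bidiffop_linearl.
- exact: bidiffop_linearr.
- elim/homogeneous_ind: G => [G H IG IH|b G bG].
    have [cD _ _ _] := linl F; have [cD' _ _ _] := linl (eta F).
    by rewrite cD !etaD psignD IG IH cD cD' -scalerDr addrACA.
  have [_ cN _ cZ] := linl F; have [_ cN' _ cZ'] := linl (eta F).
  have [_ _ _ cZr] := linr G.
  apply: two_scaleI; have := rel_cochain1_act F cP (oX 1%N isT) (mono_parity K 1)
    bG.
  rewrite mono1 !lie_theta cZ cZr (psign_parity bG) cZ' => E.
  rewrite [RHS]scalerA [_ * (-1) ^+ p]mulrC -scalerA scalerDr E.
  rewrite [_ *: ((-1) ^+ b *: _)]scalerA [_ * (-1) ^+ b]mulrC -scalerA subrK.
  by rewrite scalerA -signr_addb addbb scale1r.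
- elim/homogeneous_ind: G => [G H IG IH|b G bG].
    have [cD _ _ _] := linl F; have [cD' _ _ _] := linl (lie lambda x F).
    by rewrite lieDr !cD cD' !evD mulrDr -IG -IH addrACA.
  have := rel_cochain1_act F cP (oX 2%N isT) (mono_parity K 2) bG.
  by rewrite mono2 !scale1r => ->; rewrite evD evN subrK ev_lie_x.
elim/homogeneous_ind: G => [G H IG IH|b G bG].
  have [cD _ _ _] := linl F; have [cD' _ _ _] := linl (lie lambda xtheta F).
  by rewrite lieDr psignD cD cD' !evD opprD IG IH.
have [_ _ _ cZ'] := linl (lie lambda xtheta F).
have := rel_cochain1_act F cP (oX 3%N isT) (mono_parity K 3) bG.
rewrite mono3 (psign_parity bG) cZ' => ->.
by rewrite evD evN !evZ ev_lie_xtheta mulr0 sub0r.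
Qed.

Section Invariants.
Variables (lambda mu s : K) (c : V -> V -> V).
Hypothesis cP : invariant lambda mu s c.

Lemma inv_Dl G H F : c (G + H) F = c G F + c H F.
Proof. by have [cD _ _ _] := linear_facts (invariant_linearl cP F); apply: cD. Qed.
Lemma inv_Nl G F : c (- G) F = - c G F.
Proof. by have [_ cN _ _] := linear_facts (invariant_linearl cP F); apply: cN. Qed.
Lemma inv_Zl a G F : c (a *: G) F = a *: c G F.
Proof. by have [_ _ _ cZ] := linear_facts (invariant_linearl cP F); apply: cZ. Qed.
Lemma inv_Dr G F H : c G (F + H) = c G F + c G H.
Proof. by have [cD _ _ _] := linear_facts (invariant_linearr cP G); apply: cD. Qed.
Lemma inv_Nr G F : c G (- F) = - c G F.
Proof. by have [_ cN _ _] := linear_facts (invariant_linearr cP G); apply: cN. Qed.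
Lemma inv_Zr a G F : c G (a *: F) = a *: c G F.
Proof. by have [_ _ _ cZ] := linear_facts (invariant_linearr cP G); apply: cZ. Qed.

Lemma ev_eq0_invariant : (forall a b, ev (c (mono K a) (mono K b)) = 0) ->
  forall G F, c G F = 0.
Proof.
move=> c0 G F; pose M (GF : V * V) := c GF.1 GF.2.
rewrite -[c G F]/(M (G, F)).
move: (G, F) => {G F}; apply: (eta_stable_eq0 (M := M)) => -[G F]; rewrite /M /=.
  exists [:: (s, (eta G, F)); (s, (psign G, eta F))].
  by rewrite !big_cons big_nil addr0 /= (invariant_theta cP) scalerDr.
elim/superpoly_mono_ind: G => [G H IG IH|a G IG|a].
- by rewrite inv_Dl evD IG IH addr0.
- by rewrite inv_Zl evZ IG mulr0.
elim/superpoly_mono_ind: F => [F H IF IH|b F IF|b].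
- by rewrite inv_Dr evD IF IH addr0.
- by rewrite inv_Zr evZ IF mulr0.
exact: c0.
Qed.

Definition phi a b := ev (c (mono K a) (mono K b)).

Lemma phi_osp a b : (a < 5)%N -> phi a b = 0.
Proof.
by move=> a5; rewrite /phi (invariant_osp cP) ?linear0 //; exact: in_osp_mono.
Qed.

(** At the origin [X_(x theta)] contributes nothing on the value; on either argument it raises the
    index of the monomial by one. *)
Lemma phi_xtheta a b : lie_coef (-1) 3 a * phi a.+1 b
  = - ((-1) ^+ a * (lie_coef lambda 3 b * phi a b.+1)).
Proof.
have := invariant_xtheta cP (mono K a) (mono K b).
rewrite -mono3 !lie_mono inv_Zl inv_Zr psign_mono inv_Zl !evZ /phi.
rewrite !addSn !add0n !subSS !subn0.
move=> ->.
move: (ev _) => u. by ring.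
Qed.

Lemma lie_coef2 (l : K) b : lie_coef l 2 b = b%:R / 2 + l.
Proof.
rewrite /lie_coef /= -{4}(odd_double_half b) natrD -muln2 natrM.
by case: (odd b); rewrite /=; field.
Qed.

Lemma phi_weight a b : (a%:R / 2 + b%:R / 2 + lambda - 1 - mu) * phi a b = 0.
Proof.
have := invariant_x cP (mono K a) (mono K b).
rewrite -mono2 !lie_mono inv_Zl inv_Zr !evZ !lie_coef2 /phi.
rewrite !addKn.
by move=> E; apply/eqP; rewrite mulrBl -E subr_eq0; apply/eqP; ring.
Qed.

Lemma invariant_eq0 : (forall b, phi 5 b = 0) -> forall G F, c G F = 0.
Proof.
move=> c5; apply: ev_eq0_invariant => a b; rewrite -/(phi a b).
case: (ltnP a 5) => [/phi_osp->//|]; elim: a b => [//|a IHa] b.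
rewrite leq_eqVlt => /orP[/eqP<-//|a5].
(* The coefficient is 1/2 for odd [a] and [a / 4 - 1] for even [a]. It vanishes only at [a = 4], so
   the recursion can be solved from [a = 5] on. *)
have a3 : lie_coef (-1) 3 a != 0 :> K.
  rewrite /lie_coef /=; case oa: (odd a); first by rewrite invr_eq0 pnatr_eq0.
  rewrite mulr1 subr_eq0 -(inj_eq (mulIf (x := 2) _)) ?pnatr_eq0 //.
  rewrite divfK ?pnatr_eq0 // mul1r eqr_nat.
  by apply: contraTneq a5 => a2; rewrite -(odd_double_half a) oa a2.
by apply: (mulfI a3); rewrite phi_xtheta IHa // !mulr0 oppr0.
Qed.

End Invariants.
End Cochains.

Ltac module_ring :=
  repeat match goal with
  | |- context [lie ?a ?b ?d] => generalize (lie a b d); intro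
  | |- context [?c ?a ?b] => is_var c; generalize (c a b); intro
  end;
  apply: superpoly_eq; rewrite /= -?mul_polyC; generalize_polyC; ring.

(** * Full equivariance from equivariance at the origin *)

Section Equivariance.
Variable K : numFieldType.
Local Notation V := (superpoly K).
Local Notation x := (xvar K).
Local Notation xtheta := (xvar K * theta K).
Variables (lambda mu s : K) (c : V -> V -> V).
Hypotheses (cP : invariant lambda mu s c) (ss : s * s = 1).
Implicit Types (F G H X : V).

Let cE := (inv_Dl cP, inv_Nl cP, inv_Zl cP, inv_Dr cP, inv_Nr cP, inv_Zr cP).
Let etaE := (etaD, etaN, etaZ).

Lemma invariant_theta_act G F : c (lie (-1) (theta K) G) F =
  s *: lie mu (theta K) (c G F) - c (psign G) (lie lambda (theta K) F).
Proof.
rewrite !lie_theta !cE (invariant_theta cP).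
rewrite [s *: _]scalerA [s * _]mulrC -scalerA [s *: (s *: _)]scalerA ss scale1r.
by rewrite scalerDr addrK.
Qed.

Lemma invariant_dx G F : c (dx G) F = dx (c G F) - c G (dx F).
Proof.
rewrite -!eta_eta (invariant_theta cP) etaZ etaD !(invariant_theta cP).
rewrite eta_psign psignK !cE -scalerDr scalerA ss scale1r.
by module_ring.
Qed.

Lemma invariant_x_act G F :
  c (lie (-1) x G) F = lie mu x (c G F) - c G (lie lambda x F).
Proof.
pose M (GF : V * V) := c (lie (-1) x GF.1) GF.2 - lie mu x (c GF.1 GF.2)
  + c GF.1 (lie lambda x GF.2).
suff M0 : M (G, F) = 0 by apply/eqP; rewrite -subr_eq0 opprB addrA addrAC;
  apply/eqP.
move: (G, F) => {G F}; apply: (eta_stable_eq0 (M := M)) => -[G F]; rewrite /M /=.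
  exists [:: (s, (eta G, F)); (s, (psign G, eta F))].
  rewrite !big_cons big_nil addr0 /= !etaE eta_lie_x !(invariant_theta cP).
  rewrite !eta_lie_x !psign_lie psign_x !lieZr !lieDr !cE.
  by module_ring.
by rewrite !evD evN ev_lie_x -(invariant_x cP) addrAC subrr.
Qed.

Lemma invariant_xtheta_act G F : c (lie (-1) xtheta G) F =
  s *: lie mu xtheta (c G F) - c (psign G) (lie lambda xtheta F).
Proof.
pose M (GF : V * V) := c (lie (-1) xtheta GF.1) GF.2
  - s *: lie mu xtheta (c GF.1 GF.2) + c (psign GF.1) (lie lambda xtheta GF.2).
suff M0 : M (G, F) = 0 by apply/eqP; rewrite -subr_eq0 opprB addrA addrAC;
  apply/eqP.
move: (G, F) => {G F}; apply: (eta_stable_eq0 (M := M)) => -[G F]; rewrite /M /=.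
  (* The signs are [- s] because [X_(x theta)] is odd. Applying [eta] also produces the defect of
     [X_x], which vanishes by [invariant_x_act]; hence [X_x] had to come first. *)
  exists [:: (- s, (eta G, F)); (- s, (psign G, eta F))].
  rewrite !big_cons big_nil addr0 /= !etaE !eta_lie_xtheta !(invariant_theta cP).
  rewrite !eta_lie_xtheta !psign_lie psign_xtheta.
  rewrite eta_psign psignK !lieNl !lieZr !lieDr !cE.
  rewrite invariant_x_act !scaleNr.
  by module_ring.
by rewrite !evD evN evZ ev_lie_xtheta mulr0 subr0 (invariant_xtheta cP) addNr.
Qed.

Lemma invariant_xsqr_act G F : c (lie (-1) (x ^+ 2) G) F =
  lie mu (x ^+ 2) (c G F) - c G (lie lambda (x ^+ 2) F).
Proof.
have sqr l H : lie l (x ^+ 2) H = (2 * 2) *: lie l xtheta (lie l xtheta H).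
  by rewrite lie_xtheta_sqr scalerA mulrACA mulfV ?pnatr_eq0 // mulr1 scale1r.
rewrite !sqr !cE -[RHS]scalerBr; congr (_ *: _).
rewrite !invariant_xtheta_act psign_lie psign_xtheta lieNl !cE
  !invariant_xtheta_act psignK lieDr lieNr lieZr scalerDr scalerN !scalerA ss
    scale1r.
by module_ring.
Qed.

End Equivariance.

Lemma osp_odd (K : numFieldType) (X : superpoly K) : in_osp X ->
  has_parity true X -> exists a b, X = a *: theta K + b *: (xvar K * theta K).
Proof.
case=> k1 [k2 [k3 [k4 [k5 ->]]]] X0; exists k2, k4; apply: superpoly_eq.
  by rewrite X0 /= !(mulr0, scaler0, addr0).
by rewrite /= !(mulr0, mul0r, scaler0, addr0, add0r).
Qed.

Lemma osp_even (K : numFieldType) (X : superpoly K) : in_osp X ->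
  has_parity false X ->
  exists a b d, X = a *: 1 + b *: xvar K + d *: (xvar K ^+ 2).
Proof.
case=> k1 [k2 [k3 [k4 [k5 ->]]]] X0; exists k1, k3, k5; apply: superpoly_eq.
  by rewrite /= !(mulr0, mul0r, scaler0, addr0, add0r).
by rewrite X0 /= !(mulr0, mul0r, scaler0, addr0, add0r).
Qed.

(** By linearity it suffices to treat the five basis fields, odd and even ones apart. Equivariance
    of an explicit operator is thereby reduced to [X_theta] and to computations at the origin. *)
Lemma invariant_rel_cochain1 (K : numFieldType) (lambda mu : K) (p : bool)
    (c : superpoly K -> superpoly K -> superpoly K) :
  is_bidiffop c -> cochain_has_parity p c ->
  invariant lambda mu ((-1) ^+ p) c -> rel_cochain1 lambda mu p c.
Proof.
move=> cdiff cpar cP.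
have ss : (-1) ^+ p * (-1) ^+ p = 1 :> K by rewrite -signr_addb addbb.
split=> // [X oX|a b X G oX aX bG].
  by apply/funext => F; rewrite (invariant_osp cP).
apply/funext => F; rewrite contact_bracketE.
rewrite -[RHS]/((-1) ^+ (a && p) *: diffop_act lambda mu a (p (+) b) X (c G) F).
rewrite /diffop_act !lie_densityE scalerBr scalerA -signr_addb.
have -> : (a && p) (+) ((p (+) b) && a) = a && b by clear; case: a p b => [] [] [].
have bE : psign G = (-1) ^+ b *: G by exact: psign_parity.
have cZ d H H' : c (d *: H) H' = d *: c H H' by exact: (inv_Zl cP).
case: a aX => [/(osp_odd oX)|/(osp_even oX)] {oX}.
  case=> k1 [k2 ->]; rewrite !lieDl !lieZl.
  rewrite !(inv_Dl cP) !cZ !(inv_Dr cP) !(inv_Zr cP).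
  rewrite (invariant_theta_act cP ss) (invariant_xtheta_act cP) bE !cZ !andTb.
  by move: ((-1) ^+ p) ((-1) ^+ b) => r t; module_ring.
case=> k1 [k2 [k3 ->]]; rewrite !lieDl !lieZl.
rewrite !(inv_Dl cP) !cZ !(inv_Dr cP) !(inv_Zr cP) !lie_one (invariant_dx cP ss).
rewrite (invariant_x_act cP) (invariant_xsqr_act cP ss) !andFb expr0 !scale1r.
by module_ring.
Qed.

(** * The supertransvectants *)

Section DifferentialOperators.
Variable K : numFieldType.
Local Notation V := (superpoly K).
Implicit Types (F G : V) (A B : V -> V) (c : V -> V -> V).

Lemma sum_pad (n m : nat) (f : nat -> V) : (n <= m)%N ->
  \sum_(i < n) f i = \sum_(i < m) (if (i < n)%N then f i else 0).
Proof. by move=> nm; rewrite (big_ord_widen m f nm) big_mkcond. Qed.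

(** Padding with zero coefficients brings two operators to a common order before they are added or
    multiplied. *)
Lemma diffop_pad A : is_diffop A -> exists n, forall m, (n <= m)%N ->
  exists a : nat -> bool -> V, forall F,
    A F = \sum_(i < m) \sum_(e : bool) a i e * dmonomial i e F.
Proof.
case=> n [a AE]; exists n => m nm.
exists (fun i e => if (i < n)%N then a i e else 0) => F.
rewrite AE (sum_pad (fun i => \sum_(e : bool) a i e * dmonomial i e F) nm).
apply: eq_bigr => i _.
by case: ifP => // _; rewrite big1 // => e _; rewrite mul0r.
Qed.

Lemma bidiffop_pad c : is_bidiffop c -> exists n, forall m, (n <= m)%N ->
  exists a : nat -> bool -> nat -> bool -> V, forall G F,
    c G F = \sum_(i < m) \sum_(d : bool) \sum_(j < m) \sum_(e : bool)
              a i d j e * (dmonomial i d G * dmonomial j e F).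
Proof.
case=> n [a cE]; exists n => m nm.
exists (fun i d j e => if (i < n)%N && (j < n)%N then a i d j e else 0) => G F.
rewrite cE (sum_pad (fun i => \sum_(d : bool) \sum_(j < n) \sum_(e : bool)
  a i d j e * (dmonomial i d G * dmonomial j e F)) nm).
apply: eq_bigr => i _; case: ifP => [ni|ni]; last first.
  rewrite big1 // => d _; rewrite big1 // => j _; rewrite big1 // => e _.
  by rewrite mul0r.
apply: eq_bigr => d _.
rewrite (sum_pad (fun j => \sum_(e : bool)
  a i d j e * (dmonomial i d G * dmonomial j e F)) nm); apply: eq_bigr => j _.
by case: ifP => // _; rewrite big1 // => e _; rewrite mul0r.
Qed.

Lemma diffop_dmonomial (f : V) i e : is_diffop (fun F => f * dmonomial i e F).
Proof.
exists i.+1, (fun j d => if (j == i) && (d == e) then f else 0) => F.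
rewrite (bigD1 ord_max) //= (bigD1 e) //= !eqxx /= !big1 ?addr0 // => [j /eqP
  ji|d /negPf->].
  rewrite big1 // => d _; case: ifP; rewrite ?mul0r // => /andP[/eqP ji' _].
  by case: ji; apply: val_inj.
by rewrite mul0r.
Qed.

Lemma diffopD A B : is_diffop A -> is_diffop B -> is_diffop (fun F => A F + B F).
Proof.
move=> /diffop_pad[n An] /diffop_pad[m Bm].
have [a AE] := An _ (leq_maxl n m); have [b BE] := Bm _ (leq_maxr n m).
exists (maxn n m), (fun i e => a i e + b i e) => F.
rewrite AE BE -big_split; apply: eq_bigr => i _.
by rewrite -big_split; apply: eq_bigr => e _; rewrite /= mulrDl.
Qed.

Lemma bidiffopM A B : is_diffop A -> is_diffop B ->
  is_bidiffop (fun G F => A G * B F).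
Proof.
move=> /diffop_pad[n An] /diffop_pad[m Bm].
have [a AE] := An _ (leq_maxl n m); have [b BE] := Bm _ (leq_maxr n m).
exists (maxn n m), (fun i d j e => a i d * b j e) => G F.
rewrite AE BE mulr_suml; apply: eq_bigr => i _; rewrite mulr_suml.
apply: eq_bigr => d _; rewrite mulr_sumr; apply: eq_bigr => j _.
by rewrite mulr_sumr; apply: eq_bigr => e _; rewrite mulrACA.
Qed.

Lemma bidiffopD c c' : is_bidiffop c -> is_bidiffop c' ->
  is_bidiffop (fun G F => c G F + c' G F).
Proof.
move=> /bidiffop_pad[n cn] /bidiffop_pad[m cm].
have [a cE] := cn _ (leq_maxl n m); have [b cE'] := cm _ (leq_maxr n m).
exists (maxn n m), (fun i d j e => a i d j e + b i d j e) => G F.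
rewrite cE cE' -big_split; apply: eq_bigr => i _; rewrite -big_split.
apply: eq_bigr => d _; rewrite -big_split; apply: eq_bigr => j _.
by rewrite -big_split; apply: eq_bigr => e _; rewrite /= mulrDl.
Qed.

Lemma bidiffopZ k c : is_bidiffop c -> is_bidiffop (fun G F => k *: c G F).
Proof.
case=> n [a cE]; exists n, (fun i d j e => k *: a i d j e) => G F.
rewrite cE scaler_sumr; apply: eq_bigr => i _; rewrite scaler_sumr.
apply: eq_bigr => d _; rewrite scaler_sumr; apply: eq_bigr => j _.
by rewrite scaler_sumr; apply: eq_bigr => e _; rewrite scalerAl.
Qed.

Lemma bidiffopN c : is_bidiffop c -> is_bidiffop (fun G F => - c G F).
Proof.
move=> /(bidiffopZ (-1)); congr is_bidiffop.
by apply/funext => G; apply/funext => F; rewrite scaleN1r.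
Qed.

Lemma diffop_dx i : is_diffop (iter i (@dx K)).
Proof.
have := diffop_dmonomial 1 i false; congr is_diffop.
by apply/funext => F; rewrite mul1r.
Qed.

Lemma dtheta_iter_dx i F : iter i (@dx K) (dtheta F) = dtheta (iter i (@dx K) F).
Proof. by elim: i => [//|i /= ->]; apply: superpoly_eq; rewrite /= ?deriv0. Qed.

Lemma psign_iter_dx i F : iter i (@dx K) (psign F) = psign (iter i (@dx K) F).
Proof. by elim: i => [//|i /= ->]; apply: superpoly_eq; rewrite /= ?derivN. Qed.

Lemma diffop_etabar i : is_diffop (fun F => etabar (iter i (@dx K) F)).
Proof.
have := diffopD (diffop_dmonomial 1 i true) (diffop_dmonomial (- theta K) i.+1
  false).
congr is_diffop; apply/funext => F.
by rewrite mul1r mulNr /etabar /dmonomial iterS dtheta_iter_dx.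
Qed.

(** Since [psign F = F - 2 theta dtheta F], the parity sign is itself a differential operator. *)
Lemma diffop_psign i : is_diffop (fun F => iter i (@dx K) (psign F)).
Proof.
have := diffopD (diffop_dmonomial 1 i false) (diffop_dmonomial (- (2 *: theta K))
  i true).
congr is_diffop; apply/funext => F.
rewrite /dmonomial dtheta_iter_dx psign_iter_dx; move: (iter _ _ _) => [f g].
by apply: superpoly_eq => /=; poly_ring.
Qed.

Lemma diffop_etabar_psign i :
  is_diffop (fun F => etabar (iter i (@dx K) (psign F))).
Proof.
have := diffopD (diffop_dmonomial (-1) i true) (diffop_dmonomial (- theta K) i.+1
  false).
congr is_diffop; apply/funext => F.
rewrite /dmonomial dtheta_iter_dx psign_iter_dx iterS etabarE;
  move: (iter _ _ _) => [f g].
by apply: superpoly_eq => /=; poly_ring.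
Qed.

End DifferentialOperators.

(** * Invariance of the explicit formulas *)

Lemma osp_deriv (K : numFieldType) (X : superpoly K) : in_osp X ->
  (body X)^`()^`()^`() = 0 /\ (soul X)^`()^`() = 0.
Proof.
by case=> [a [b [d [e [f ->]]]]] /=; split; poly_ring.
Qed.

Ltac jet_field :=
  repeat match goal with
  | |- context [jet ?n ?F] => generalize (jet n F); intro
  end; field.

Section Upsilon.
Variable K : numFieldType.
Local Notation V := (superpoly K).
Implicit Types (lambda : K) (F G : V).

Lemma Upsilon_bidiffop lambda k : is_bidiffop (Upsilon lambda k).
Proof.
have zero : is_bidiffop (fun _ _ : V => 0 : V).
  by exists 0%N, (fun _ _ _ _ => 0) => G F; rewrite big_ord0.
case: k => [|[|[|[|[|[|[|[|[|k]]]]]]]]] //=; rewrite /Upsilon.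
- exact: (bidiffopM (diffop_etabar K 2) (diffop_dx K 0)).
- apply: bidiffopD; [apply: bidiffopZ|apply: bidiffopN].
    exact: (bidiffopM (diffop_dx K 3) (diffop_dx K 0)).
  exact: (bidiffopM (diffop_etabar_psign K 2) (diffop_etabar K 0)).
- apply: bidiffopD; last first.
    apply: bidiffopN; exact: (bidiffopM (diffop_psign K 3) (diffop_etabar K 0)).
  apply: bidiffopD; [apply: bidiffopZ|apply: bidiffopN; apply: bidiffopZ].
    exact: (bidiffopM (diffop_etabar K 3) (diffop_dx K 0)).
  exact: (bidiffopM (diffop_etabar K 2) (diffop_dx K 1)).
- apply: bidiffopD; [apply: bidiffopD|apply: bidiffopZ].
  + exact: (bidiffopM (diffop_etabar_psign K 2) (diffop_etabar K 1)).
  + apply: bidiffopN; apply: bidiffopZ; apply: bidiffopD.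
      exact: (bidiffopM (diffop_etabar_psign K 3) (diffop_etabar K 0)).
    exact: (bidiffopM (diffop_dx K 3) (diffop_dx K 1)).
  exact: (bidiffopM (diffop_dx K 4) (diffop_dx K 0)).
- apply: bidiffopD; [apply: bidiffopD; [apply: bidiffopD|apply: bidiffopZ]|].
  + exact: (bidiffopM (diffop_etabar_psign K 2) (diffop_etabar K 2)).
  + apply: bidiffopN; apply: bidiffopZ; apply: bidiffopD.
      apply: bidiffopZ.
      exact: (bidiffopM (diffop_etabar_psign K 3) (diffop_etabar K 1)).
    exact: (bidiffopM (diffop_dx K 3) (diffop_dx K 2)).
  + apply: bidiffopD; last apply: bidiffopZ.
      exact: (bidiffopM (diffop_etabar_psign K 4) (diffop_etabar K 0)).
    exact: (bidiffopM (diffop_dx K 4) (diffop_dx K 1)).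
  apply: bidiffopN; apply: bidiffopZ.
  exact: (bidiffopM (diffop_dx K 5) (diffop_dx K 0)).
Qed.

Lemma Upsilon_parity lambda k : cochain_has_parity (odd k) (Upsilon lambda k).
Proof.
move=> q [g0 g1] qG r [f0 f1] rF.
case: k => [|[|[|[|[|[|[|[|[|k]]]]]]]]]; rewrite /Upsilon ?etabarE;
  try by case: (_ (+) _).
all: case: q qG => /= qG; case: r rF => /= rF; subst; poly_ring.
Qed.

(** The formulas have constant coefficients and are built from [dx] and [etabar], which commute with
    [eta] up to sign. *)
Lemma Upsilon_theta lambda k G F : eta (Upsilon lambda k G F) =
  (-1) ^+ odd k *:
    (Upsilon lambda k (eta G) F + Upsilon lambda k (psign G) (eta F)).
Proof.
case: G F => [g0 g1] [f0 f1].
case: k => [|[|[|[|[|[|[|[|[|k]]]]]]]]]; rewrite /Upsilon ?etabarE;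
  try by rewrite addr0 scaler0 etaE.
all: rewrite /= ?expr1 ?expr0 ?scaleN1r ?scale1r ?etabarE.
all: apply: superpoly_eq; rewrite /=; poly_ring.
Qed.

(** The field enters only through derivatives of order at least 3 of its body and at least 2 of its
    soul, and these vanish on osp(1|2). *)
Lemma Upsilon_osp lambda k X F : in_osp X -> Upsilon lambda k X F = 0.
Proof.
case/osp_deriv; case: X F => [x0 x1] [f0 f1] /= X0 X1.
case: k => [|[|[|[|[|[|[|[|[|k]]]]]]]]] //; rewrite /Upsilon ?etabarE.
all: apply: superpoly_eq; rewrite /= ?derivN ?X0 ?X1 ?deriv0.
all: rewrite ?derivN ?X1 ?deriv0; poly_ring.
Qed.

Ltac ev_Upsilon_tac G F :=
  rewrite /Upsilon !etabarE /jet /ev; case: G F => [g0 g1] [f0 f1] /=;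
  rewrite ?derivN ?(coefD, coefN, coefZ, coef0M); ring.

(** At the origin each formula is a bilinear form in jets whose orders add up to [k + 2]. Invariance
    under [X_x] and [X_(x theta)] thus becomes an identity between its coefficients, by [jet_lie_x]
    and [jet_lie_xtheta]. *)
Lemma ev_Upsilon3 lambda G F : ev (Upsilon lambda 3 G F) = jet 5 G * jet 0 F.
Proof. ev_Upsilon_tac G F. Qed.

Lemma ev_Upsilon4 lambda G F : ev (Upsilon lambda 4 G F) =
  2 / 3 * lambda * (jet 6 G * jet 0 F) + jet 5 G * jet 1 F.
Proof. ev_Upsilon_tac G F. Qed.

Lemma ev_Upsilon5 lambda G F : ev (Upsilon lambda 5 G F) =
  2 * lambda * (jet 7 G * jet 0 F) - 3 * (jet 5 G * jet 2 F)
  - jet 6 G * jet 1 F.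
Proof. ev_Upsilon_tac G F. Qed.

Lemma ev_Upsilon6 lambda G F : ev (Upsilon lambda 6 G F) =
  - (jet 5 G * jet 3 F)
  + (2 * lambda + 1) / 3 * (jet 7 G * jet 1 F - jet 6 G * jet 2 F)
  + lambda * (2 * lambda + 1) / 6 * (jet 8 G * jet 0 F).
Proof. ev_Upsilon_tac G F. Qed.

Lemma ev_Upsilon8 lambda G F : ev (Upsilon lambda 8 G F) =
  - (jet 5 G * jet 5 F)
  + 2 * (lambda + 1) / 3 * (2 * (jet 7 G * jet 3 F) - jet 6 G * jet 4 F)
  + (lambda + 1) * (2 * lambda + 1) / 6 *
      (2 * (jet 8 G * jet 2 F) - jet 9 G * jet 1 F)
  - lambda * (lambda + 1) * (2 * lambda + 1) / 15 * (jet 10 G * jet 0 F).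
Proof. ev_Upsilon_tac G F. Qed.

Lemma jet_psign n G : jet n (psign G) = (-1) ^+ n * jet n G.
Proof.
elim: n G => [|n IHn] G; first by rewrite mul1r.
by rewrite !jetS eta_psign linearN /= IHn exprS mulN1r mulNr.
Qed.

Lemma Upsilon_invariant lambda k : k \in [:: 3; 4; 5; 6; 8]%N ->
  invariant lambda (lambda + k%:R / 2) ((-1) ^+ odd k) (Upsilon lambda k).
Proof.
move=> k5; split=> [F|G|G F|X F /Upsilon_osp->|G F|G F] //.
- exact/bidiffop_linearl/Upsilon_bidiffop.
- exact/bidiffop_linearr/Upsilon_bidiffop.
- exact: Upsilon_theta.
- move: k5; rewrite !inE => /or4P[/eqP->|/eqP->|/eqP->|/orP[]/eqP->].
  + by move: (Upsilon _ _) (ev_Upsilon3 lambda) => c cE; rewrite !cE !jet_lie_x;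
    jet_field.
  + by move: (Upsilon _ _) (ev_Upsilon4 lambda) => c cE; rewrite !cE !jet_lie_x;
    jet_field.
  + by move: (Upsilon _ _) (ev_Upsilon5 lambda) => c cE; rewrite !cE !jet_lie_x;
    jet_field.
  + by move: (Upsilon _ _) (ev_Upsilon6 lambda) => c cE; rewrite !cE !jet_lie_x;
    jet_field.
  by move: (Upsilon _ _) (ev_Upsilon8 lambda) => c cE; rewrite !cE !jet_lie_x;
    jet_field.
have coefE := (jet_lie_xtheta, jet_psign).
move: k5; rewrite !inE => /or4P[/eqP->|/eqP->|/eqP->|/orP[]/eqP->].
+ by move: (Upsilon _ _) (ev_Upsilon3 lambda) => c cE;
  rewrite !cE !coefE /xtheta_coef /=; jet_field.
+ by move: (Upsilon _ _) (ev_Upsilon4 lambda) => c cE;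
  rewrite !cE !coefE /xtheta_coef /=; jet_field.
+ by move: (Upsilon _ _) (ev_Upsilon5 lambda) => c cE;
  rewrite !cE !coefE /xtheta_coef /=; jet_field.
+ by move: (Upsilon _ _) (ev_Upsilon6 lambda) => c cE;
  rewrite !cE !coefE /xtheta_coef /=; jet_field.
by move: (Upsilon _ _) (ev_Upsilon8 lambda) => c cE;
  rewrite !cE !coefE /xtheta_coef /=; jet_field.
Qed.

End Upsilon.

(** * The cocycle condition *)

Section Cocycles.
Variable K : numFieldType.
Local Notation V := (superpoly K).
Variables (lambda mu : K) (p : bool) (c : V -> V -> V).
Hypothesis cochain : rel_cochain1 lambda mu p c.
Implicit Types (F G H X : V).

Let cP : invariant lambda mu ((-1) ^+ p) c := rel_cochain1_invariant cochain.
Let cE := (inv_Dl cP, inv_Nl cP, inv_Zl cP, inv_Dr cP, inv_Nr cP, inv_Zr cP).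

(* The differential of c, evaluated on arguments G and H of parities a and b. *)
Definition delta1 (a b : bool) G H F : V :=
  (-1) ^+ (a && p) *: lie mu G (c H F) - (-1) ^+ (a && b) *: c H (lie lambda G F)
  - (-1) ^+ (a && b) *: ((-1) ^+ (b && p) *: lie mu H (c G F))
  + c G (lie lambda H F) - c (lie (-1) G H) F.

Lemma delta1E a b G H :
  (-1) ^+ (a && p) *: diffop_act lambda mu a (p (+) b) G (c H)
    - (-1) ^+ (b && (a (+) p)) *: diffop_act lambda mu b (p (+) a) H (c G)
    - c (contact_bracket G H) = delta1 a b G H.
Proof.
apply/funext => F; rewrite contact_bracketE.
rewrite -[LHS]/((-1) ^+ (a && p) *: diffop_act lambda mu a (p (+) b) G (c H) F
  - (-1) ^+ (b && (a (+) p)) *: diffop_act lambda mu b (p (+) a) H (c G) F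
  - c (lie (-1) G H) F).
rewrite /diffop_act !lie_densityE /delta1.
have -> : (-1) ^+ (b && (a (+) p)) = (-1) ^+ (a && b) * (-1) ^+ (b && p) :> K.
  by rewrite -signr_addb; clear; case: a p b => [] [] [].
have -> : (-1) ^+ ((p (+) b) && a) = (-1) ^+ (a && b) * (-1) ^+ (a && p) :> K.
  by rewrite -signr_addb; clear; case: a p b => [] [] [].
have -> : (-1) ^+ ((p (+) a) && b) = (-1) ^+ (a && b) * (-1) ^+ (b && p) :> K.
  by rewrite -signr_addb; clear; case: a p b => [] [] [].
case: (a && b) (a && p) (b && p) => [] [] [];
  rewrite ?expr0 ?expr1 ?mulr1 ?mulrNN ?mul1r ?scaleN1r ?scale1r; module_ring.
Qed.

(** The differential inherits invariance under [X_theta]: [eta] is distributed over the three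
    arguments, with the signs for moving past [c], [G] and [H]. *)
Lemma eta_delta1 a b G H F : has_parity a G -> has_parity b H ->
  eta (delta1 a b G H F) = (-1) ^+ p *: delta1 (~~ a) b (eta G) H F
    + ((-1) ^+ (p (+) a) *: delta1 a (~~ b) G (eta H) F
    + (-1) ^+ (p (+) a (+) b) *: delta1 a b G H (eta F)).
Proof.
move=> /psign_parity Ga /psign_parity Hb; rewrite /delta1.
have th := invariant_theta cP.
rewrite !(etaD, etaN, etaZ, eta_lie, th, psign_lie, Ga, Hb).
case: a {Ga} b {Hb} p => [] [] []; rewrite /= ?expr0 ?expr1 ?scaleN1r ?scale1r.
all: rewrite ?(lieNl, lieNr, lieDr, cE).
all: module_ring.
Qed.

(** The signs in [delta1] depend on prescribed parities. Projecting to homogeneous components lets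
    the arguments range over all superpolynomials, as a family indexed for [eta_stable_eq0]
    requires. *)
Definition homog (a : bool) G : V :=
  if a then SuperPoly 0 (soul G) else SuperPoly (body G) 0.

Lemma homog_parity a G : has_parity a (homog a G).
Proof. by case: a. Qed.

Lemma homog_id a G : has_parity a G -> homog a G = G.
Proof. by case: a G => [] [g0 g1] /= ->. Qed.

Lemma homogD a F G : homog a (F + G) = homog a F + homog a G.
Proof. by case: a; apply: superpoly_eq; rewrite /= ?addr0. Qed.

Lemma homogZ a k F : homog a (k *: F) = k *: homog a F.
Proof. by case: a; apply: superpoly_eq; rewrite /= ?scaler0. Qed.

Lemma homog_mono a n : homog a (mono K n) = if odd n == a then mono K n else 0.
Proof. by rewrite /mono; case: a (odd n) => [] [] //=; apply: superpoly_eq. Qed.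

(** As [c] vanishes on osp(1|2), the cocycle condition with one argument there is just
    equivariance. *)
Lemma delta1_ospl a b X H F : has_parity a X -> has_parity b H -> in_osp X ->
  delta1 a b X H F = 0.
Proof.
move=> aX bH oX; have c0 F' : c X F' = 0 by exact: (invariant_osp cP).
rewrite /delta1 !c0 (rel_cochain1_act F cochain oX aX bH).
by rewrite -(scale0r 1) lieZr !scale0r !scaler0 subr0 addr0 subrr.
Qed.

Lemma delta1_ospr a b G X F : has_parity a G -> has_parity b X -> in_osp X ->
  delta1 a b G X F = 0.
Proof.
move=> aG bX oX; have c0 F' : c X F' = 0 by exact: (invariant_osp cP).
rewrite /delta1 !c0 (bracket_skew aG bX) (inv_Zl cP).
rewrite (rel_cochain1_act F cochain oX bX aG).
rewrite -(scale0r 1) lieZr !scale0r !scaler0 subr0 [b && a]andbC.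
have rr : (-1) ^+ (a && b) * (-1) ^+ (a && b) = 1 :> K.
  by rewrite -signr_addb addbb.
rewrite scaleNr opprK scalerBr [_ *: (_ *: c G _)]scalerA rr scale1r.
by rewrite sub0r [X in _ + X]addrC addrA addrK addNr.
Qed.

(** On [mono m] the result is a multiple of [mono (n + m - 2)], whose index is positive here. *)
Lemma ev_lie_mono n F l : (2 < n)%N -> ev (lie l (mono K n) F) = 0.
Proof.
move=> n3; elim/superpoly_mono_ind: F => [F G IF IG|k F IF|m].
- by rewrite lieDr evD IF IG addr0.
- by rewrite lieZr evZ IF mulr0.
rewrite lie_mono evZ ev_mono; case: eqP => [|_]; last by rewrite mulr0.
lia.
Qed.

(* The body at the origin of the differential of c on mono a, mono b, mono d;
   the terms in which a vector field acts last vanish there as a, b > 2. *)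
Definition defect a b d : K :=
  - ((-1) ^+ (odd a && odd b) * (lie_coef lambda a d * phi c b (a + d - 2)))
  + lie_coef lambda b d * phi c a (b + d - 2)
  - lie_coef (-1) a b * phi c (a + b - 2) d.

Lemma ev_delta1 a b d : (2 < a)%N -> (2 < b)%N ->
  ev (delta1 (odd a) (odd b) (mono K a) (mono K b) (mono K d)) = defect a b d.
Proof.
move=> a3 b3; rewrite /delta1 !(evD, evN, evZ) !ev_lie_mono // !lie_mono !cE !evZ.
by rewrite /defect /phi; ring.
Qed.

Lemma delta1_linear a b k (G G' H F : V) :
  (delta1 a b (k *: G + G') H F = k *: delta1 a b G H F + delta1 a b G' H F) *
  (delta1 a b H (k *: G + G') F = k *: delta1 a b H G F + delta1 a b H G' F) *
  (delta1 a b H F (k *: G + G') = k *: delta1 a b H F G + delta1 a b H F G').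
Proof.
rewrite /delta1 !(lieDl, lieZl, lieDr, lieZr, cE).
move: ((-1) ^+ (a && p)) ((-1) ^+ (a && b)) ((-1) ^+ (b && p)) => r t u.
by split; [split|]; module_ring.
Qed.

(** By [eta_delta1] the values of the differential form a family stable under [eta], so only the
    origin and monomials matter. A monomial of index below 5 lies in osp(1|2), where the
    differential vanishes. *)
Lemma cocycle_of_defect :
  (forall a b d, (4 < a)%N -> (4 < b)%N -> defect a b d = 0) ->
  rel_cocycle1 lambda mu p c.
Proof.
move=> defect0; split=> // a b G H aG bH; rewrite delta1E.
apply/funext => F; rewrite -[RHS]/(0 : V) -(homog_id aG) -(homog_id bH) {aG bH}.
(* The parities are part of the index, since [eta] flips one of them when it falls on [G] or [H]. *)
pose M (i : bool * bool * V * V * V) := let: (a, b, G, H, F) := i in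
  delta1 a b (homog a G) (homog b H) F.
rewrite -[LHS]/(M (a, b, G, H, F)); move: (a, b, G, H, F) => {a b G H F}.
apply: (eta_stable_eq0 (M := M)) => -[[[[a b] G] H] F]; rewrite /M.
  exists [:: ((-1) ^+ p, (~~ a, b, eta G, H, F));
     ((-1) ^+ (p (+) a), (a, ~~ b, G, eta H, F));
     ((-1) ^+ (p (+) a (+) b), (a, b, G, H, eta F))].
  rewrite (eta_delta1 F (homog_parity a G) (homog_parity b H)).
  rewrite !big_cons big_nil addr0.
  have etah d X : eta (homog d X) = homog (~~ d) (eta X).
    by case: d; apply: superpoly_eq; rewrite /= ?deriv0.
  by rewrite !etah.
have lin1 H' F' : linear (fun G' => delta1 a b G' H' F').
  by move=> k G1 G2; rewrite delta1_linear.
have lin2 G' F' : linear (fun H' => delta1 a b G' H' F').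
  by move=> k G1 G2; rewrite delta1_linear.
have lin3 G' H' : linear (fun F' => delta1 a b G' H' F').
  by move=> k G1 G2; rewrite delta1_linear.
elim/superpoly_mono_ind: G => [G G' IG IG'|k G IG|m].
- have [/= D _ _ _] := linear_facts (lin1 (homog b H) F).
  by rewrite homogD D evD IG IG' addr0.
- have [/= _ _ _ Z] := linear_facts (lin1 (homog b H) F).
  by rewrite homogZ Z evZ IG mulr0.
elim/superpoly_mono_ind: H => [H H' IH IH'|k H IH|n].
- have [/= D _ _ _] := linear_facts (lin2 (homog a (mono K m)) F).
  by rewrite homogD D evD IH IH' addr0.
- have [/= _ _ _ Z] := linear_facts (lin2 (homog a (mono K m)) F).
  by rewrite homogZ Z evZ IH mulr0.
elim/superpoly_mono_ind: F => [F F' IF IF'|k F IF|d].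
- have [/= D _ _ _] := linear_facts (lin3 (homog a (mono K m)) (homog b (mono K
  n))).
  by rewrite D evD IF IF' addr0.
- have [/= _ _ _ Z] := linear_facts (lin3 (homog a (mono K m)) (homog b (mono K
  n))).
  by rewrite Z evZ IF mulr0.
rewrite !homog_mono; have [_ _ /= Z1 _] := linear_facts (lin1 (mono K n) (mono K
  d)).
have [_ _ /= Z2 _] := linear_facts (lin2 (mono K m) (mono K d)).
have [_ _ /= Z3 _] := linear_facts (lin1 0 (mono K d)).
case: eqP => [ma|_]; case: eqP => [nb|_]; rewrite ?Z1 ?Z2 ?Z3 ?linear0 //.
subst a b; have [m5|m5] := ltnP m 5.
  by rewrite (delta1_ospl _ (mono_parity K m) (mono_parity K n) (@in_osp_mono K m
    m5)) linear0.
have [n5|n5] := ltnP n 5.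
  by rewrite (delta1_ospr _ (mono_parity K m) (mono_parity K n) (@in_osp_mono K n
    n5)) linear0.
by rewrite ev_delta1 ?defect0 // (leq_trans _ m5, leq_trans _ n5).
Qed.

Lemma defect_cocycle a b d : rel_cocycle1 lambda mu p c ->
  (4 < a)%N -> (4 < b)%N -> defect a b d = 0.
Proof.
case=> _ coc a5 b5.
rewrite -ev_delta1 ?(leq_trans _ a5) ?(leq_trans _ b5) //.
rewrite -delta1E; have := coc _ _ _ _ (mono_parity K a) (mono_parity K b) => ->.
by rewrite -[X in ev X]/(0 : V) linear0.
Qed.

End Cocycles.

(** * Obstructions to the cocycle condition *)

Section Obstruction.
Variable K : numFieldType.
Local Notation V := (superpoly K).
Variables (lambda mu s : K) (c : V -> V -> V).
Hypothesis cP : invariant lambda mu s c.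
Local Notation phi := (phi c).
Local Notation defect := (defect lambda c).
Local Notation kappa := (lie_coef lambda 3).

Lemma kappa_even l : kappa l.*2 = l%:R / 2 + lambda.
Proof. by rewrite /lie_coef /= odd_double doubleK mulr1. Qed.

Lemma kappa_odd l : kappa l.*2.+1 = 2^-1.
Proof. by rewrite /lie_coef /= odd_double. Qed.

(** This solves [phi_xtheta] for its left side. The constant [u] is 2 for odd [a] and
    [- 4 / (a - 4)] for even [a], whence the numerals in the next seven lemmas. *)
Lemma phi_step a b (u : K) : u * lie_coef (-1) 3 a = - (-1) ^+ a ->
  phi a.+1 b = u * kappa b * phi a b.+1.
Proof.
move=> ua; have a0 : lie_coef (-1) 3 a != 0 :> K.
  by apply: contra_eq_neq ua => ->; rewrite mulr0 eq_sym oppr_eq0 signr_eq0.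
apply: (mulfI a0); rewrite (phi_xtheta cP) -mulNr -ua.
by move: (lie_coef _ _ _) (lie_coef _ _ _) (phi _ _) => ? ? ?; ring.
Qed.

Lemma phi6 b : phi 6 b = 2 * kappa b * phi 5 b.+1.
Proof. by apply: phi_step; rewrite /lie_coef /=; field. Qed.
Lemma phi7 b : phi 7 b = - 2 * kappa b * phi 6 b.+1.
Proof. by apply: phi_step; rewrite /lie_coef /=; field. Qed.
Lemma phi8 b : phi 8 b = 2 * kappa b * phi 7 b.+1.
Proof. by apply: phi_step; rewrite /lie_coef /=; field. Qed.
Lemma phi9 b : phi 9 b = - 1 * kappa b * phi 8 b.+1.
Proof. by apply: phi_step; rewrite /lie_coef /=; field. Qed.
Lemma phi10 b : phi 10 b = 2 * kappa b * phi 9 b.+1.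
Proof. by apply: phi_step; rewrite /lie_coef /=; field. Qed.
Lemma phi11 b : phi 11 b = - (2 / 3) * kappa b * phi 10 b.+1.
Proof. by apply: phi_step; rewrite /lie_coef /=; field. Qed.
Lemma phi12 b : phi 12 b = 2 * kappa b * phi 11 b.+1.
Proof. by apply: phi_step; rewrite /lie_coef /=; field. Qed.

(** Here [k = 2 l + 7], and the factor vanishes exactly at [lambda = - (k - 1) / 4], the weight for
    which [etabar ^ k] is invariant. *)
Lemma defect55_odd l : defect 5 5 l.*2.+1 =
  ((l%:R + 3) / 2 + lambda) * phi 5 l.*2.+4.
Proof.
rewrite /defect (_ : 5 + l.*2.+1 - 2 = l.*2.+4)%N ?addSn ?subSS ?subn0 //.
rewrite [phi (5 + 5 - 2) _]phi8 phi7 phi6 kappa_odd -[l.*2.+3]/(l.+1.*2.+1)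
  kappa_odd.
rewrite -[l.*2.+2]/(l.+1.*2) kappa_even /lie_coef /= odd_double /=.
by rewrite -[l.+1]addn1 natrD; move: (phi _ _) => t; field.
Qed.

(** Here [k = 2 l + 6]. The factor is [lambda * (2 lambda + 5)] for [l = 0] and
    [2 lambda ^ 2 + 7 lambda + 2] for [l = 1], which produces the special weights for [k = 6] and
    [k = 8]. *)
Lemma defect55_even l : defect 5 5 l.*2 =
  (l%:R + 4 * lambda + (l%:R + 2 * lambda) * (l%:R + 1 + 2 * lambda) / 2)
    * phi 5 l.*2.+3.
Proof.
rewrite /defect (_ : 5 + l.*2 - 2 = l.*2.+3)%N ?addSn ?subSS ?subn0 //.
rewrite [phi (5 + 5 - 2) _]phi8 phi7 phi6 kappa_even kappa_odd.
rewrite -[l.*2.+2]/(l.+1.*2) kappa_even /lie_coef /= odd_double doubleK /=.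
by rewrite -[l.+1]addn1 natrD; move: (phi _ _) => t; field.
Qed.

Lemma defect59_even q : defect 5 9 q.*2 =
  (q%:R / 2 + 2 * lambda) * phi 9 q.*2.+3
  + (q%:R / 2 + 4 * lambda) * phi 5 q.*2.+4.+3 - phi 12 q.*2 / 2.
Proof.
rewrite /defect !addSn !add0n !subSS !subn0 /lie_coef /= odd_double doubleK /=.
by move: (phi _ _) (phi _ _) (phi _ _) => ? ? ?; field.
Qed.

(** For [k = 2 q + 10] a second triple is available. Both defects are multiples of the same
    coefficient, and their two factors have no common zero when [q] is a natural number. *)
Lemma defect55_59_even q : defect 5 5 q.+2.*2 = 0 -> defect 5 9 q.*2 = 0 ->
  phi 5 q.*2.+4.+3 = 0.
Proof.
move=> E5 E9; have [//|t0] := eqVneq (phi 5 q.*2.+4.+3) 0.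
move: E5; rewrite defect55_even => /eqP; rewrite mulf_eq0 (negPf t0) orbF.
move: E9; rewrite defect59_even phi12 phi11 phi10 phi9 phi8 phi7 phi6.
rewrite !(kappa_even, kappa_odd).
rewrite -[q.*2.+2]/(q.+1.*2) -[q.*2.+3]/(q.+1.*2.+1) !(kappa_even, kappa_odd).
rewrite -[q.*2.+4]/(q.+2.*2) -[q.*2.+4.+1]/(q.+2.*2.+1) !(kappa_even, kappa_odd).
rewrite -[q.*2.+4.+2]/(q.+3.*2) kappa_even.
rewrite -[q.+3.*2.+1]/(q.*2.+4.+3) -[q.+2.*2.+3]/(q.*2.+4.+3).
move: (phi 5 _) t0 => t t0; rewrite -[q.+3]addn3 -[q.+2]addn2 -[q.+1]addn1 !natrD.
(* In terms of r = l + 2 lambda with l = q + 2, the first equation expresses l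
   through r, and the second one becomes (r + 1) (r + 2) (r + 3) (r + 4) = 0;
   then l is -2 or -3. *)
have [r rE] : exists r, r = q%:R + 2 + 2 * lambda by exists (q%:R + 2 + 2 * lambda).
have lE : lambda = (r - q%:R - 2) / 2 by rewrite rE; field.
have q_neq (a : nat) : (q%:R == - a.+1%:R :> K) = false.
  by apply/eqP => /eqP; rewrite -subr_eq0 opprK -natrD pnatr_eq0 addnS.
move: (q%:R) q_neq rE lE => n n_neq _ -> E9 /eqP E5.
have nE : n = 2 * r - 2 + r * (r + 1) / 2.
  by apply/eqP; rewrite -subr_eq0 -oppr_eq0 -[X in _ == X]E5; apply/eqP; field.
have : (r + 1) * (r + 2) * (r + 3) * (r + 4) == 0.
  have : - (r + 1) * (r + 2) * (r + 3) * (r + 4) / 24 * t = 0.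
    by rewrite -[RHS]E9 nE; field.
  by move=> /eqP; rewrite mulf_eq0 (negPf t0) orbF !mulf_eq0 oppr_eq0 invr_eq0
    pnatr_eq0 orbF.
rewrite !mulf_eq0 !addr_eq0 -!orbA => /or4P[]/eqP rE; move: nE; rewrite rE => nE.
- by have /eqP[] := negbT (n_neq 3%N); rewrite nE; field.
- by have /eqP[] := negbT (n_neq 4%N); rewrite nE; field.
- by have /eqP[] := negbT (n_neq 4%N); rewrite nE; field.
by have /eqP[] := negbT (n_neq 3%N); rewrite nE; field.
Qed.

End Obstruction.

(** * Relative 0-cochains and their coboundaries *)

Section ZeroCochains.
Variable K : numFieldType.
Local Notation V := (superpoly K).
Local Notation x := (xvar K).
Local Notation xtheta := (xvar K * theta K).
Implicit Types (F G H X : V) (lambda mu s : K).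

(** The module axiom is needed for [X_x] and [X_(x theta)] only, these being the fields that occur
    in [invariant]. *)
Lemma lie_x_bracket mu G F : lie mu (lie (-1) x G) F =
  lie mu x (lie mu G F) - lie mu G (lie mu x F).
Proof.
case: G F => [g0 g1] [f0 f1]; rewrite !lieE !scaleN1r.
by apply: superpoly_eq => /=; poly_ring.
Qed.

Lemma lie_xtheta_bracket mu G F : lie mu (lie (-1) xtheta G) F =
  lie mu xtheta (lie mu G F) - lie mu (psign G) (lie mu xtheta F).
Proof.
rewrite xthetaE; case: G F => [g0 g1] [f0 f1]; rewrite !lieE !scaleN1r.
by apply: superpoly_eq => /=; poly_ring.
Qed.

Lemma eta_mono n :
  eta (mono K n) = (if odd n then 1 else n./2%:R) *: mono K n.-1.
Proof.
rewrite /mono; case: n => [|n]; first by apply: superpoly_eq;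
  rewrite /= ?derivC ?scale0r.
rewrite /= uphalf_half; case: (odd n) => /=.
  apply: superpoly_eq; rewrite /= ?scaler0 // add1n derivXn -scaler_nat.
  by congr (_ *: 'X^_).
by rewrite add0n; apply: superpoly_eq; rewrite /= ?scale1r ?deriv0.
Qed.

Lemma jet_mono n m : jet n (mono K m) = (if n == m then (n./2)`!%:R else 0).
Proof.
elim: n m => [|n IHn] m; first by rewrite [LHS]ev_mono eq_sym; case: eqP.
rewrite jetS eta_mono linearZ /= IHn; case: m => [|m] /=; first by rewrite mul0r.
rewrite eqSS; case: eqP => [<-|_]; last by rewrite mulr0.
rewrite uphalf_half; case: (odd n) => /=; last by rewrite mul1r.
by rewrite add1n factS natrM.
Qed.

(** * The invariant operator [etabar ^ (2 m + 1)] and its coboundary *)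

Section Coboundary.
Variables (m : nat) (k : K).
Let lambda : K := - (m%:R / 2).
Let mu : K := lambda + m.*2.+1%:R / 2.

(* A multiple of etabar ^ (2 m + 1), as etabar ^ 2 = - dx. *)
Definition etabar_dx F : V := k *: etabar (iter m (@dx K) F).
Local Notation v := etabar_dx.

Fact etabar_dx_linear : linear v.
Proof.
move=> a F G; rewrite /v !etabarE.
have -> : iter m (@dx K) (a *: F + G) = a *: iter m (@dx K) F + iter m (@dx K) G.
  elim: m => [//|n /= ->]; apply: superpoly_eq; rewrite /= derivD derivZ //.
by apply: superpoly_eq; rewrite /= ?derivD ?derivZ -!mul_polyC; generalize_polyC;
  ring.
Qed.

Let vE := linear_facts etabar_dx_linear.
Let vD : {morph v : F G / F + G}. Proof. by case: vE. Qed.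
Let vN : {morph v : F / - F}. Proof. by case: vE. Qed.
Let vZ a : {morph v : F / a *: F}. Proof. by case: vE. Qed.

Lemma eta_etabar_dx F : eta (v F) = - v (eta F).
Proof.
rewrite /v etaZ -scalerN; congr (_ *: _).
have -> : iter m (@dx K) (eta F) = eta (iter m (@dx K) F).
  by elim: m => [//|n /= ->]; apply: superpoly_eq.
by rewrite !etabarE; apply: superpoly_eq; rewrite /= ?opprK ?derivN.
Qed.

Lemma ev_etabar_dx F : ev (v F) = k * jet m.*2.+1 F.
Proof.
rewrite evZ etabarE; congr (_ * _); rewrite /jet iterS /ev /=.
suff -> : iter m (@dx K) F = iter m.*2 eta F by [].
by elim: m => [//|n IHn]; rewrite doubleS !iterS IHn.
Qed.

Lemma etabar_dx_x F : lie mu x (v F) = v (lie lambda x F).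
Proof.
pose M F := lie mu x (v F) - v (lie lambda x F).
suff M0 : M F = 0 by apply/eqP; rewrite -subr_eq0; apply/eqP.
move: F; apply: (eta_stable_eq0 (M := M)) => F; rewrite /M.
  exists [:: (-1, eta F)]; rewrite big_cons big_nil addr0 /=.
  rewrite etaD etaN eta_etabar_dx !eta_lie_x !eta_etabar_dx lieNr vD vZ.
  by rewrite scaleN1r opprB opprK scalerN addrACA addNr add0r addrC.
by rewrite evD evN ev_lie_x !ev_etabar_dx jet_lie_x /mu; jet_field.
Qed.

Lemma etabar_dx_xtheta F : lie mu xtheta (v F) = - v (lie lambda xtheta F).
Proof.
pose M F := lie mu xtheta (v F) + v (lie lambda xtheta F).
suff M0 : M F = 0 by apply/eqP; rewrite -addr_eq0; apply/eqP.
move: F; apply: (eta_stable_eq0 (M := M)) => F; rewrite /M.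
  exists [:: (1, eta F)]; rewrite big_cons big_nil addr0 /=.
  rewrite etaD eta_lie_xtheta !eta_etabar_dx eta_lie_xtheta lieNr vD vN etabar_dx_x.
  by rewrite scale1r opprB opprK [X in _ + X]addrC addrACA subrr add0r.
rewrite evD ev_lie_xtheta ev_etabar_dx jet_lie_xtheta add0r.
(* This is where [lambda = - (m / 2)] enters: the coefficient of [X_(x theta)] on jets of order
   [2 m + 1] is [m / 2 + lambda]. *)
by rewrite /xtheta_coef /= odd_double uphalf_double /lambda subrr mul0r mulr0.
Qed.

Lemma etabar_dx_theta F :
  lie mu (theta K) (v F) = - v (lie lambda (theta K) F).
Proof. by rewrite !lie_theta eta_etabar_dx vZ scalerN. Qed.

Lemma etabar_dx_one F : lie mu 1 (v F) = v (lie lambda 1 F).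
Proof. by rewrite !lie_one -!eta_eta !eta_etabar_dx etaN eta_etabar_dx opprK. Qed.

Lemma etabar_dx_xsqr F : lie mu (x ^+ 2) (v F) = v (lie lambda (x ^+ 2) F).
Proof.
have sqr l H : lie l (x ^+ 2) H = (2 * 2) *: lie l xtheta (lie l xtheta H).
  by rewrite lie_xtheta_sqr scalerA mulrACA mulfV ?pnatr_eq0 // mulr1 scale1r.
by rewrite !sqr vZ !etabar_dx_xtheta lieNr etabar_dx_xtheta opprK.
Qed.

Lemma etabar_dx_cochain0 : rel_cochain0 lambda mu true v.
Proof.
split.
- have := diffopD (diffop_dmonomial (k *: 1) m true)
    (diffop_dmonomial (- (k *: theta K)) m.+1 false).
  congr is_diffop; apply/funext => F; rewrite /v /etabar scalerBr.
  by rewrite -scalerAl mul1r mulNr -scalerAl /dmonomial dtheta_iter_dx.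
- move=> q [f0 f1] qF; rewrite /v etabarE.
  have -> : iter m (@dx K) (SuperPoly f0 f1) = SuperPoly f0^`(m) f1^`(m).
    by elim: m => [|n /= ->]; rewrite ?derivn0 ?derivnS.
  by case: q qF => /= ->; rewrite linear0 ?deriv0 ?oppr0 scaler0.
move=> a X oX aX; apply/funext => F.
rewrite /diffop_act !lie_densityE -[RHS]/(0 : V).
case: a aX => [/(osp_odd oX)|/(osp_even oX)] {oX}.
  case=> k1 [k2 ->]; rewrite !lieDl !lieZl expr1 scaleN1r opprK vD !vZ.
  by rewrite etabar_dx_theta etabar_dx_xtheta !scalerN -opprD addNr.
case=> k1 [k2 [k3 ->]]; rewrite !lieDl !lieZl expr0 scale1r !vD !vZ.
by rewrite etabar_dx_one etabar_dx_x etabar_dx_xsqr subrr.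
Qed.

(** The sign of the coboundary of the odd operator [v] is absorbed into [psign G], so the formula
    also applies to inhomogeneous [G]. *)
Definition delta0 G F : V := lie mu (psign G) (v F) - v (lie lambda G F).

Lemma delta0_act a G : has_parity a G ->
  delta0 G = (-1) ^+ (a && true) *: diffop_act lambda mu a true G v.
Proof.
move=> aG; apply/funext => F; rewrite /delta0 (psign_parity aG) lieZl.
rewrite -[RHS]/((-1) ^+ (a && true) *: diffop_act lambda mu a true G v F).
rewrite /diffop_act !lie_densityE andbT andTb scalerBr scalerA -signr_addb addbb.
by rewrite scale1r.
Qed.

(** Vanishing on osp(1|2) is the invariance of [v]; the remaining clauses combine it with the module
    axiom. *)
Lemma delta0_invariant : invariant lambda mu (-1) delta0.
Proof.
split=> [F a G H|G a F H|G F|X F|G F|G F]; rewrite /delta0.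
- rewrite psignD psignZ !lieDl !lieZl vD vZ; module_ring.
- by rewrite vD vZ !lieDr !lieZr vD vZ; module_ring.
- rewrite etaD etaN eta_lie !eta_etabar_dx eta_lie psignK eta_psign lieNl !lieNr.
  by rewrite vD scaleN1r; module_ring.
- case=> [k1 [k2 [k3 [k4 [k5 ->]]]]].
  rewrite !psignD !psignZ psign_x psign_xtheta.
  have -> : psign 1 = 1 :> V by apply: superpoly_eq; rewrite /= ?oppr0.
  have -> : psign (theta K) = - theta K by apply: superpoly_eq; rewrite /= ?oppr0.
  have -> : psign (x ^+ 2) = x ^+ 2 by apply: superpoly_eq;
    rewrite /= ?mulr0 ?mul0r ?addr0 ?oppr0.
  rewrite !lieDl !lieZl !lieNl !vD !vZ etabar_dx_one etabar_dx_x etabar_dx_xsqr.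
  by rewrite etabar_dx_theta etabar_dx_xtheta !opprK subrr.
- rewrite psign_lie psign_x !lie_x_bracket vD vN (etabar_dx_x F).
  rewrite -(etabar_dx_x (lie lambda G F)) !(evD, evN) !ev_lie_x.
  by move: (ev _) (ev _) (ev _) (ev _) => *; ring.
rewrite psign_lie psign_xtheta !lieNl !lie_xtheta_bracket psignK vD vN.
rewrite etabar_dx_xtheta lieNr !(evD, evN) !opprK.
have -> : v (lie lambda xtheta (lie lambda G F)) = - lie mu xtheta (v (lie lambda
  G F)).
  by rewrite etabar_dx_xtheta opprK.
rewrite !ev_lie_xtheta !evN ev_lie_xtheta.
by move: (ev _) (ev _) => *; ring.
Qed.

(** Only the term where the field acts first survives at the origin. For [k <> 0] the value is
    nonzero, so the coboundary spans the line of cochains. *)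
Lemma phi_delta0 (b : nat) : m.*2.+1 = (b + 3)%N ->
  phi delta0 5 b = k * ((m%:R + 1) / 2) * (m`!)%:R.
Proof.
move=> mb; have bE : b = m.-1.*2 by lia.
have m1 : m = m.-1.+1 by lia.
rewrite /phi /delta0 psign_mono lieZl evD evN evZ ev_lie_mono // mulr0 add0r.
rewrite lie_mono vZ evZ ev_etabar_dx (_ : 5 + b - 2 = m.*2.+1)%N; last by lia.
rewrite jet_mono eqxx /= uphalf_double /lie_coef /= bE odd_double doubleK /lambda.
have -> : m.-1%:R = m%:R - 1 :> K by rewrite {2}m1 -[m.-1.+1]addn1 natrD addrK.
by move: (m`!) (m%:R) => f n; field.
Qed.

End Coboundary.
End ZeroCochains.

(** * Classification *)

Section Classification.
Variable K : numFieldType.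
Local Notation V := (superpoly K).
Implicit Types (lambda mu s : K) (c : V -> V -> V) (p : bool).

Lemma phi_support lambda s c k a b :
  invariant lambda (lambda + k%:R / 2) s c -> (a + b != k + 2)%N ->
  phi c a b = 0.
Proof.
move=> cP abk; have /eqP := phi_weight cP a b.
have -> : a%:R / 2 + b%:R / 2 + lambda - 1 - (lambda + k%:R / 2)
    = ((a + b)%:R - (k + 2)%:R) / 2 :> K by rewrite !natrD; field.
by rewrite !mulf_eq0 subr_eq0 eqr_nat (negPf abk) invr_eq0 pnatr_eq0 => /eqP.
Qed.

Lemma defect_support lambda s c k a b d :
  invariant lambda (lambda + k%:R / 2) s c -> (4 < a)%N -> (4 < b)%N ->
  (a + b + d != k + 4)%N -> defect lambda c a b d = 0.
Proof.
move=> cP a5 b5 /eqP abd; rewrite /defect !(phi_support cP) ?mulr0 ?subr0 ?oppr0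
  ?addr0 //.
all: lia.
Qed.

Lemma cochain_cocycle lambda k p c :
  rel_cochain1 lambda (lambda + k%:R / 2) p c ->
  [\/ (k < 6)%N, k = 6 /\ lambda * (2 * lambda + 5) = 0 |
      k = 8 /\ 2 * lambda ^+ 2 + 7 * lambda + 2 = 0] ->
  rel_cocycle1 lambda (lambda + k%:R / 2) p c.
Proof.
move=> cochain kP; apply: (cocycle_of_defect cochain) => a b d a5 b5.
have cP := rel_cochain1_invariant cochain.
have [abd|] := eqVneq (a + b + d)%N (k + 4)%N; last exact: (defect_support cP).
case: kP => [|[k6 l0]|[k8 l0]]; first by lia.
  have [-> [-> ->]] : a = 5 /\ b = 5 /\ d = 0.*2 by lia.
  rewrite (defect55_even cP) -[X in X * _](_ : lambda * (2 * lambda + 5) = _).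
    by rewrite l0 mul0r.
  by rewrite /=; field.
have close u t : u * (2 * lambda ^+ 2 + 7 * lambda + 2) * t = 0 :> K.
  by rewrite l0 mulr0 mul0r.
(* For [k = 8] all coefficients lie on the line [a + b = 10]; the recursion expresses them through
   [phi c 5 5]. *)
have t6 : phi c 6 4 = 2 * (1 + lambda) * phi c 5 5.
  by rewrite (phi6 cP) (kappa_even lambda 2) divff ?pnatr_eq0.
have t7 : phi c 7 3 = - (phi c 6 4).
  by rewrite (phi7 cP) (kappa_odd lambda 1); move: (phi _ _ _) => t; field.
have t8 : phi c 8 2 = 2 * (2^-1 + lambda) * phi c 7 3.
  by rewrite (phi8 cP) (kappa_even lambda 1) mul1r.
have t9 : phi c 9 1 = - (phi c 8 2) / 2.
  by rewrite (phi9 cP) (kappa_odd lambda 0); move: (phi _ _ _) => t; field.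
have t10 : phi c 10 0 = 2 * lambda * phi c 9 1.
  by rewrite (phi10 cP) (kappa_even lambda 0) mul0r add0r.
rewrite /defect.
(* The triples with [a + b + d = 12] and [a, b >= 5] are checked one by one. Each defect is a
   multiple of the quadratic polynomial in [lambda] or vanishes identically. *)
have [a5'|[a6|a7]] : a = 5 \/ a = 6 \/ a = 7 by lia.
- have [[b' d']|[[b' d']|[b' d']]] : b = 5 /\ d = 2 \/ b = 6 /\ d = 1 \/ b = 7 /\
  d = 0 by lia.
  + rewrite a5' b' d' -[LHS]/(defect lambda c 5 5 1.*2) (defect55_even cP).
    by rewrite -(close 1 (phi c 5 5)) -[1.*2.+3]/5%N; congr (_ * _); field.
  + rewrite a5' b' d' -[(5 + 6 - 2)%N]/9%N -[(5 + 1 - 2)%N]/4%N -[(6 + 1 -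
    2)%N]/5%N.
    rewrite t9 t8 t7 t6 -(close 2^-1 (phi c 5 5)); move: (phi c 5 5) => t.
    by rewrite /lie_coef /=; field.
  rewrite a5' b' d' -[(5 + 7 - 2)%N]/10%N -[(5 + 0 - 2)%N]/3%N -[(7 + 0 - 2)%N]/5%N.
  rewrite t10 t9 t8 t7 t6 -(close (- lambda) (phi c 5 5)); move: (phi c 5 5) => t.
  by rewrite /lie_coef /=; field.
- have [[b' d']|[b' d']] : b = 5 /\ d = 1 \/ b = 6 /\ d = 0 by lia.
  + rewrite a6 b' d' -[(6 + 5 - 2)%N]/9%N -[(5 + 1 - 2)%N]/4%N -[(6 + 1 - 2)%N]/5%N.
    rewrite t9 t8 t7 t6 -(close (- 2^-1) (phi c 5 5)); move: (phi c 5 5) => t.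
    by rewrite /lie_coef /=; field.
  (* This triple imposes nothing: the first two terms cancel, and the bracket of [x ^ 3] with itself
     is 0. *)
  rewrite a6 b' d' -[(6 + 6 - 2)%N]/10%N -[(6 + 0 - 2)%N]/4%N.
  by move: (phi c 6 4) (phi c 10 0) => t u; rewrite /lie_coef /=; field.
have [b' d'] : b = 5 /\ d = 0 by lia.
rewrite a7 b' d' -[(7 + 5 - 2)%N]/10%N -[(5 + 0 - 2)%N]/3%N -[(7 + 0 - 2)%N]/5%N.
rewrite t10 t9 t8 t7 t6 -(close (- lambda) (phi c 5 5)); move: (phi c 5 5) => t.
by rewrite /lie_coef /=; field.
Qed.

Lemma cocycle_obstruction lambda p c b :
  rel_cocycle1 lambda (lambda + (b + 3)%:R / 2) p c -> phi c 5 b != 0 ->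
  [\/ (b < 3)%N,
      b = 3 /\ lambda * (2 * lambda + 5) = 0,
      b = 5 /\ 2 * lambda ^+ 2 + 7 * lambda + 2 = 0 |
      exists2 m, b = m.-1.*2 & (0 < m)%N /\ lambda = - (m%:R / 2)].
Proof.
move=> coc t0; have cP := rel_cochain1_invariant coc.1.
have [b3|b3] := ltnP b 3; first by constructor 1.
have E55 d := defect_cocycle coc.1 d coc (isT : (4 < 5)%N) (isT : (4 < 5)%N).
have E59 d := defect_cocycle coc.1 d coc (isT : (4 < 5)%N) (isT : (4 < 9)%N).
(* As [k = b + 3], even [b] means odd [k]. In both cases the triple used first is
   [(5, 5, b - 3)]. *)
have [ob|eb] := boolP (odd b); last first.
  constructor 4; exists b./2.+1; first by rewrite /= even_halfK.
  split=> //; have [l lE] : exists l, b = l.*2.+4.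
    by exists b./2.-2; rewrite -{1}(even_halfK eb); lia.
  have := E55 l.*2.+1; rewrite (defect55_odd cP) -lE => /eqP.
  rewrite mulf_eq0 (negPf t0) orbF lE => /eqP E.
  rewrite -[l.*2.+4]/(l.+2.*2) doubleK -[l.+3]addn3 natrD; apply/eqP.
  by rewrite -addr_eq0 addrC; apply/eqP; rewrite -E; field.
have [l lE] : exists l, b = l.*2.+3.
  by exists (b - 3)./2; rewrite -{1}(odd_double_half b) ob; lia.
have := E55 l.*2; rewrite (defect55_even cP) -lE => /eqP.
rewrite mulf_eq0 (negPf t0) orbF => /eqP E.
(* The values [l = 0] and [l = 1] are [k = 6] and [k = 8]; from [l = 2] on the triple
   [(5, 9, l.*2 - 4)] exists and rules out a nonzero coefficient. *)
case: l lE E => [|[|q]] lE E.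
- by constructor 2; split=> //; rewrite -E; field.
- by constructor 3; split=> //; rewrite -E; field.
case/eqP: t0; rewrite lE -[q.+2.*2.+3]/(q.*2.+4.+3).
exact: (defect55_59_even cP (E55 _) (E59 _)).
Qed.

Lemma phi_parity p c a b : cochain_has_parity p c ->
  p (+) odd a (+) odd b -> phi c a b = 0.
Proof.
move=> cp pab; have := cp _ _ (mono_parity K a) _ _ (mono_parity K b).
by rewrite /phi /ev pab /= => ->; rewrite coef0.
Qed.

Lemma rel_cochain1_eq0 lambda mu p c : rel_cochain1 lambda mu p c ->
  (forall b, phi c 5 b = 0) -> c = 0.
Proof.
move=> /rel_cochain1_invariant cP c0.
by apply/funext => G; apply/funext => F; rewrite (invariant_eq0 cP c0).
Qed.

(** A nonzero cochain has some nonzero [phi c 5 b]; its weight under [X_x] determines [mu], and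
    being the body of a value it determines the parity. *)
Lemma rel_cochain1_cases lambda mu p c : rel_cochain1 lambda mu p c ->
  c = 0 \/ exists b, [/\ mu = lambda + (b + 3)%:R / 2, phi c 5 b != 0 & p = odd
    (b + 3)].
Proof.
move=> cochain; have [c0|] := pselect (forall b, phi c 5 b = 0).
  by left; apply: (rel_cochain1_eq0 cochain c0).
move=> /existsNP[b /eqP t0]; right; exists b; split=> //.
  have /eqP := phi_weight (rel_cochain1_invariant cochain) 5 b.
  rewrite mulf_eq0 (negPf t0) orbF subr_eq0 => /eqP <-.
  by rewrite natrD; field.
have [_ cp _ _] := cochain; apply/eqP; apply: contraNT t0 => pb.
apply/eqP/(phi_parity cp); move: pb; rewrite oddD.
by case: p (odd b) {cp cochain} => [] [].
Qed.

Lemma invariantB lambda mu s c c' (k : K) :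
  invariant lambda mu s c -> invariant lambda mu s c' ->
  invariant lambda mu s (fun G F => c G F - k *: c' G F).
Proof.
move=> cP cP'; split=> [F a G H|G a F H|G F|X F oX|G F|G F].
- rewrite !(inv_Dl cP, inv_Zl cP, inv_Dl cP', inv_Zl cP').
  by module_ring.
- rewrite !(inv_Dr cP, inv_Zr cP, inv_Dr cP', inv_Zr cP').
  by module_ring.
- rewrite etaD etaN etaZ (invariant_theta cP) (invariant_theta cP').
  by module_ring.
- by rewrite (invariant_osp cP) ?(invariant_osp cP') // scaler0 subr0.
- rewrite !(evD, evN, evZ) mulrBr -(invariant_x cP) mulrCA -(invariant_x cP').
  by move: (ev _) (ev _) (ev _) (ev _) => *; ring.
rewrite !(evD, evN, evZ) (invariant_xtheta cP) (invariant_xtheta cP').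
by move: (ev _) (ev _) => *; ring.
Qed.

(** The difference of the two sides is invariant and all its coefficients [phi 5 d] vanish: for
    [d = b] by the choice of the factor, otherwise by weight. *)
Lemma invariant_unique lambda s c c' b :
  invariant lambda (lambda + (b + 3)%:R / 2) s c ->
  invariant lambda (lambda + (b + 3)%:R / 2) s c' -> phi c' 5 b != 0 ->
  c = (phi c 5 b / phi c' 5 b) *: c'.
Proof.
move=> cP cP' t0; set k := _ / _.
have dP := invariantB k cP cP'.
apply/funext => G; apply/funext => F; apply/eqP; rewrite -subr_eq0; apply/eqP.
rewrite -[LHS]/(c G F - k *: c' G F); apply: (invariant_eq0 dP) => d.
have [->|db] := eqVneq d b.
  by rewrite /phi evD evN evZ divfK ?subrr.
by apply: (phi_support dP); apply: contraNneq db => ?; apply/eqP; lia.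
Qed.

Lemma zero_cochain0 lambda mu p : rel_cochain0 lambda mu p (0 : V -> V).
Proof.
split.
- by exists 0%N, (fun _ _ => 0) => F; rewrite big_ord0.
- by move=> q F _; case: (_ (+) _).
move=> a X _ _; apply/funext => F; rewrite /diffop_act !lie_densityE.
by rewrite -[(0 : V -> V) F]/(0 : V) -[(0 : V -> V) _]/(0 : V) scaler0 subr0
  (linear0 (lie mu X)).
Qed.

Lemma zero_cochain1 lambda mu p : rel_cochain1 lambda mu p (0 : V -> V -> V).
Proof.
split=> //.
- by exists 0%N, (fun _ _ _ _ => 0) => G F; rewrite big_ord0.
- by move=> q G _ r F _; case: (_ (+) _).
move=> a b X G oX aX _; have [_ _ /(_ a X oX aX)] := zero_cochain0 lambda mu (p
  (+) b).
by rewrite -[(0 : V -> V -> V) G]/(0 : V -> V) => ->; rewrite scaler0.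
Qed.

Lemma zero_coboundary1 lambda mu p : rel_coboundary1 lambda mu p (0 : V -> V -> V).
Proof.
split; first exact: zero_cochain1.
exists 0; split; first exact: zero_cochain0.
move=> a G _; apply/funext => F; rewrite -[RHS]/((-1) ^+ (a && p) *: diffop_act
  lambda mu a p G 0 F).
rewrite /diffop_act !lie_densityE -[(0 : V -> V) F]/(0 : V) -[(0 : V -> V) _]/(0
  : V).
by rewrite scaler0 subr0 (linear0 (lie mu G)) scaler0.
Qed.

(** Cochains form a line, and [delta0] gives a nonzero point on it. Hence [c] is the coboundary of a
    rescaled [etabar ^ (2 m + 1)]. *)
Lemma coboundary_etabar p c m (lambda := - (m%:R / 2) : K) : (0 < m)%N ->
  rel_cochain1 lambda (lambda + m.*2.+1%:R / 2) p c ->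
  rel_coboundary1 lambda (lambda + m.*2.+1%:R / 2) p c.
Proof.
move=> m0 cochain; have [->|[b [muE t0 pE]]] := rel_cochain1_cases cochain.
  exact: zero_coboundary1.
have mb : m.*2.+1 = (b + 3)%N.
  by apply/eqP; rewrite -(eqr_nat K); move/addrI: muE => /(mulIf _) ->;
    rewrite ?invr_eq0 ?pnatr_eq0.
have pT : p = true by rewrite pE -mb /= odd_double.
clear pE; subst p; split=> //.
have vP := delta0_invariant m (1 : K); have := rel_cochain1_invariant cochain.
rewrite expr1 /lambda => cP.
have d0 : phi (delta0 m (1 : K)) 5 b != 0.
  rewrite (phi_delta0 _ mb) !mulf_neq0 ?oner_eq0 ?invr_eq0 ?pnatr_eq0 //.
  - by rewrite natr1 pnatr_eq0.
  - by rewrite -lt0n fact_gt0.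
have mu2 : - (m%:R / 2) + m.*2.+1%:R / 2 = - (m%:R / 2) + (b + 3)%:R / 2 :> K by
  rewrite mb.
rewrite mu2 in cP vP; have cE := invariant_unique cP vP d0.
exists (etabar_dx m (phi c 5 b / phi (delta0 m (1 : K)) 5 b)).
split; first exact: etabar_dx_cochain0.
move=> a G aG; rewrite -(delta0_act _ _ aG); rewrite {1}cE.
move: (_ / _) => k; apply/funext => F; rewrite -[LHS]/(k *: delta0 m (1 : K) G F).
by rewrite /delta0 /etabar_dx !scale1r lieZr -scalerBr.
Qed.

(** By [X_theta] it suffices to look at the values on monomials at the origin. The weight under
    [X_x] leaves only [mono k], which is then handled with [X_(x theta)]. *)
Lemma rel_cochain0_eq0 lambda k p v : (0 < k)%N ->
  ~ (odd k /\ lambda = - (k./2%:R / 2)) ->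
  rel_cochain0 lambda (lambda + k%:R / 2) p v -> v = 0.
Proof.
move=> k0 nodd [vdiff _ vosp].
have vl := diffop_linear vdiff; have [vD _ v0 vZ] := linear_facts vl.
have vact a X F : in_osp X -> has_parity a X ->
    lie (lambda + k%:R / 2) X (v F) = (-1) ^+ (p && a) *: v (lie lambda X F).
  move=> oX aX; have := congr1 (fun f => f F) (vosp a X oX aX).
  by rewrite /diffop_act !lie_densityE => /eqP; rewrite subr_eq0 => /eqP.
apply/funext; apply: (eta_stable_eq0 (M := v)) => F.
  exists [:: ((-1) ^+ p, eta F)]; rewrite big_cons big_nil addr0 /=.
  have := vact true _ F (in_osp_mono K (isT : (1 < 5)%N)) (mono_parity K 1).
  by rewrite mono1 !lie_theta vZ andbT scalerA mulrC -scalerA => /two_scaleI.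
elim/superpoly_mono_ind: F => [F G IF IG|a F IF|b].
- by rewrite vD evD IF IG addr0.
- by rewrite vZ evZ IF mulr0.
have [bk|bk] := eqVneq b k; last first.
  have := congr1 (@ev K) (vact false _ (mono K b) (in_osp_mono K (isT : (2 <
    5)%N)) (mono_parity K 2)).
  rewrite mono2 ev_lie_x andbF scale1r -mono2 lie_mono lie_coef2 addKn vZ evZ.
  move=> /eqP; rewrite -subr_eq0 -mulrBl mulf_eq0 => /orP[|/eqP//].
  rewrite [b%:R / 2 + _]addrC opprD addrACA subrr add0r -mulrBl mulf_eq0 invr_eq0
    pnatr_eq0 orbF.
  by rewrite subr_eq0 eqr_nat eq_sym (negPf bk).
(* [X_(x theta)] maps [mono k.-1] to a multiple of [mono k]. That multiple is zero only in the
   excluded case, [k] odd and [lambda = - (k - 1) / 4]. *)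
have := congr1 (@ev K) (vact true _ (mono K k.-1) (in_osp_mono K (isT : (3 <
  5)%N)) (mono_parity K 3)).
rewrite mono3 ev_lie_xtheta -mono3 lie_mono vZ scalerA evZ.
rewrite (_ : 3 + k.-1 - 2 = k)%N; last by lia.
move=> /esym/eqP; rewrite bk !mulf_eq0 signr_eq0 /= => /orP[|/eqP//].
rewrite /lie_coef /=; case ok: (odd k.-1); first by rewrite invr_eq0 pnatr_eq0.
have k1 : k = k.-1./2.*2.+1 by rewrite -{1}(prednK k0) -{1}(odd_double_half k.-1)
  ok.
rewrite mulr1 addrC addr_eq0 => /eqP lE; case: nodd.
by rewrite k1 /= odd_double uphalf_double.
Qed.

Lemma B1_eq0 lambda k c : (0 < k)%N -> ~ (odd k /\ lambda = - (k./2%:R / 2)) ->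
  B1 lambda (lambda + k%:R / 2) c -> c = 0.
Proof.
move=> k0 nodd.
have cob0 p c' : rel_coboundary1 lambda (lambda + k%:R / 2) p c' -> c' = 0.
  case=> cochain [v [/(rel_cochain0_eq0 k0 nodd) -> cE]].
  have cP := rel_cochain1_invariant cochain.
  apply/funext => G; apply/funext => F; rewrite -[RHS]/(0 : V).
  elim/homogeneous_ind: G => [G H IG IH|a G aG];
    first by rewrite (inv_Dl cP) IG IH addr0.
  rewrite (cE a G aG).
  rewrite -[LHS]/((-1) ^+ (a && p) *: diffop_act lambda (lambda + k%:R / 2) a p G
    0 F).
  rewrite /diffop_act !lie_densityE -[(0 : V -> V) F]/(0 : V) -[(0 : V -> V)
    _]/(0 : V).
  by rewrite scaler0 subr0 (linear0 (lie _ G)) scaler0.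
by case=> c0 [c1 [/cob0 -> /cob0 -> ->]]; rewrite addr0.
Qed.

(** Only the term [jet 5 G * jet b F] contributes, and its coefficient does not involve [lambda]; so
    the formulas span the cochains for every weight. *)
Lemma phi_Upsilon_neq0 lambda b : b \in [:: 0; 1; 2; 3; 5]%N ->
  phi (Upsilon lambda (b + 3)) 5 b != 0.
Proof.
have nz (n : nat) : - n.+1%:R != 0 :> K by rewrite oppr_eq0 pnatr_eq0.
rewrite /phi !inE => /or4P[/eqP->|/eqP->|/eqP->|/orP[]/eqP->].
- rewrite ev_Upsilon3 !jet_mono /= -natrM pnatr_eq0 //.
- rewrite ev_Upsilon4 !jet_mono /= mul0r mulr0 add0r -natrM pnatr_eq0 //.
- rewrite ev_Upsilon5 !jet_mono /= !(mul0r, mulr0) sub0r subr0 -!natrM; exact: nz.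
- rewrite ev_Upsilon6 !jet_mono /= !(mul0r, mulr0, subr0, addr0) -natrM; exact: nz.
rewrite ev_Upsilon8 !jet_mono /= !(mul0r, mulr0, subr0, addr0) -natrM; exact: nz.
Qed.

Lemma Upsilon_cochain lambda k : k \in [:: 3; 4; 5; 6; 8]%N ->
  rel_cochain1 lambda (lambda + k%:R / 2) (odd k) (Upsilon lambda k).
Proof.
move=> kP; apply: invariant_rel_cochain1.
- exact: Upsilon_bidiffop.
- exact: Upsilon_parity.
- exact: Upsilon_invariant.
Qed.

Lemma even_odd_sum_homogeneous (P : bool -> (V -> V -> V) -> Prop) p c :
  (forall q, P q 0) -> P p c -> even_odd_sum P c.
Proof.
by move=> P0; case: p => Pc; [exists 0, c; rewrite add0r|exists c, 0;
  rewrite addr0].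
Qed.

Lemma C1_Upsilon lambda k c : k \in [:: 3; 4; 5; 6; 8]%N ->
  C1 lambda (lambda + k%:R / 2) c -> exists a, c = a *: Upsilon lambda k.
Proof.
move=> kP [c0 [c1 [c0P c1P ->]]].
have [b kE] : exists b, k = (b + 3)%N.
  by exists (k - 3)%N; move: kP; rewrite !inE; lia.
subst k; have t0 : phi (Upsilon lambda (b + 3)) 5 b != 0.
  by apply: phi_Upsilon_neq0; move: kP; rewrite !inE; lia.
have prop p c' : rel_cochain1 lambda (lambda + (b + 3)%:R / 2) p c' ->
    exists a, c' = a *: Upsilon lambda (b + 3).
  move=> cochain; have [->|[b' [muE _ pE]]] := rel_cochain1_cases cochain.
    by exists 0; rewrite scale0r.
  have kb : (b + 3 = b' + 3)%N.
    by apply/eqP; rewrite -(eqr_nat K); move/addrI: muE => /(mulIf _) ->;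
      rewrite ?invr_eq0 ?pnatr_eq0.
  have cP := rel_cochain1_invariant cochain.
  have uP := Upsilon_invariant lambda kP.
  rewrite pE -kb in cP.
  by eexists; apply: (invariant_unique cP uP t0).
have [a0 ->] := prop _ _ c0P; have [a1 ->] := prop _ _ c1P.
by exists (a0 + a1); rewrite scalerDl.
Qed.

End Classification.

(** * Computation of the first cohomology *)

Section FirstCohomology.
Variable K : numFieldType.
Local Notation V := (superpoly K).
Implicit Types (lambda mu s : K) (c : V -> V -> V) (p : bool).

Lemma B1_zero lambda mu : B1 lambda mu (0 : V -> V -> V).
Proof. exists 0, 0; split; [exact: zero_coboundary1..|by rewrite addr0]. Qed.

(** This governs only when [Upsilon] is a cocycle. Being a coboundary is the separate case of odd
    [k] with [lambda = - (k - 1) / 4], that is -1/2 for [k = 3] and -1 for [k = 5]. *)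
Definition Upsilon_cocycle_cond lambda (k : nat) : Prop :=
  [\/ (k < 6)%N, k = 6 /\ lambda * (2 * lambda + 5) = 0 |
      k = 8 /\ 2 * lambda ^+ 2 + 7 * lambda + 2 = 0].

(** Here the cocycles are exactly the multiples of [Upsilon], and 0 is the only coboundary. *)
Lemma H1_Upsilon lambda k : k \in [:: 3; 4; 5; 6; 8]%N ->
  Upsilon_cocycle_cond lambda k -> ~ (odd k /\ lambda = - (k./2%:R / 2)) ->
  [/\ is_supertransvectant lambda k (Upsilon lambda k),
      H1_spanned_by lambda (lambda + k%:R / 2) (Upsilon lambda k) &
      H1_dim lambda (lambda + k%:R / 2) 1].
Proof.
move=> kP coc nodd; have k0 : (0 < k)%N by move: kP; rewrite !inE; lia.
have cochain := Upsilon_cochain lambda kP.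
have U0 : Upsilon lambda k <> 0.
  have [b kE] : exists b, k = (b + 3)%N by exists (k - 3)%N; move: kP;
    rewrite !inE; lia.
  have /eqP t0 : phi (Upsilon lambda (b + 3)) 5 b != 0.
    by apply: phi_Upsilon_neq0; move: kP; rewrite kE !inE; lia.
  move=> E; apply: t0; rewrite -kE E /phi.
  by rewrite -[(0 : V -> V -> V) _ _]/(0 : V) linear0.
have CU : C1 lambda (lambda + k%:R / 2) (Upsilon lambda k).
  by apply: even_odd_sum_homogeneous cochain => q; exact: zero_cochain1.
have Z0 q : rel_cocycle1 lambda (lambda + k%:R / 2) q (0 : V -> V -> V).
  apply: cocycle_of_defect (zero_cochain1 _ _ _) _ => a b d _ _.
  have z e f : phi (0 : V -> V -> V) e f = 0.
    by rewrite /phi -[(0 : V -> V -> V) _ _]/(0 : V) linear0.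
  by rewrite /defect !z !mulr0 !oppr0 !addr0.
have ZU : Z1 lambda (lambda + k%:R / 2) (Upsilon lambda k).
  exact: even_odd_sum_homogeneous Z0 (cochain_cocycle cochain coc).
have span : H1_spanned_by lambda (lambda + k%:R / 2) (Upsilon lambda k).
  split=> // z [c0 [c1 [[c0P _] [c1P _] zE]]].
  have [|a ->] := @C1_Upsilon K lambda k z kP; first by exists c0, c1.
  by exists (fun _ => a); rewrite big_ord1 subrr; exact: B1_zero.
split=> //; first by split=> // J' /(C1_Upsilon kP).
exists (fun _ => Upsilon lambda k); split=> // a; rewrite big_ord1.
move=> /(B1_eq0 k0 nodd)/eqP; rewrite scaler_eq0 => /orP[/eqP a0|/eqP//] i.
by rewrite ord1.
Qed.

Lemma cocycle_coboundary lambda mu p c : rel_cocycle1 lambda mu p c ->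
  rel_coboundary1 lambda mu p c \/
  exists k, [/\ k \in [:: 3; 4; 5; 6; 8]%N, mu = lambda + k%:R / 2,
    Upsilon_cocycle_cond lambda k & ~ (odd k /\ lambda = - (k./2%:R / 2))].
Proof.
move=> coc; have [->|[b [muE t0 _]]] := rel_cochain1_cases coc.1.
  by left; exact: zero_coboundary1.
have cob m : b = m.-1.*2 -> (0 < m)%N -> lambda = - (m%:R / 2) ->
    rel_coboundary1 lambda mu p c.
  move=> bE m0 lE; have bm : (b + 3 = m.*2.+1)%N by rewrite bE; lia.
  by case: coc => cochain _; move: cochain; rewrite muE bm lE;
    exact: coboundary_etabar.
rewrite muE in coc; case: (cocycle_obstruction coc t0) => [b3|[bE l0]|[bE l0]|[m
  bE [m0 lE]]].
(* These are [k = 3, 4, 5], where every cochain is a cocycle; the first case covers the excluded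
   weights -1/2 and -1. *)
- have [lb|lb] := pselect (odd (b + 3) /\ lambda = - ((b + 3)./2%:R / 2)).
    left; apply: (cob (b + 3)./2); [|lia|exact: lb.2].
    by case: lb; case: b b3 {cob coc t0 muE} => [|[|[|]]].
  right; exists (b + 3)%N; split=> //; last by constructor 1; lia.
  by move: b3; case: b {lb cob coc t0 muE} => [|[|[|]]].
- right; exists (b + 3)%N; rewrite bE; split=> //; first by rewrite -bE.
    by constructor 2.
  by case.
- right; exists (b + 3)%N; rewrite bE; split=> //; first by rewrite -bE.
    by constructor 3.
  by case.
by left; apply: (cob m).
Qed.

Lemma H1_zero lambda mu :
  ~ (exists k, [/\ k \in [:: 3; 4; 5; 6; 8]%N, mu = lambda + k%:R / 2,
    Upsilon_cocycle_cond lambda k & ~ (odd k /\ lambda = - (k./2%:R / 2))]) ->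
  H1_dim lambda mu 0.
Proof.
move=> none; exists (fun _ => 0); split=> [|a _ []//].
split=> [[]//|z [c0 [c1 [c0P c1P ->]]]].
exists (fun _ => 0); rewrite big_ord0 subr0; exists c0, c1; split=> //.
  by case: (cocycle_coboundary c0P).
by case: (cocycle_coboundary c1P).
Qed.

(** The parameter [s] stands for a square root of 33, which lets the real and complex cases be
    treated together. *)
Definition exceptional lambda mu s : Prop :=
  (mu - lambda = 3 / 2 /\ lambda <> - (1 / 2)) \/
  (mu - lambda = 2) \/
  (mu - lambda = 5 / 2 /\ lambda <> - 1) \/
  (mu - lambda = 3 /\ (lambda = 0 \/ lambda = - (5 / 2))) \/
  (mu - lambda = 4 /\
     (lambda = (- 7 + s) / 4 \/ lambda = (- 7 - s) / 4)).

Lemma exceptionalP lambda mu s : s ^+ 2 = 33 -> exceptional lambda mu s <->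
  exists k, [/\ k \in [:: 3; 4; 5; 6; 8]%N, mu = lambda + k%:R / 2,
    Upsilon_cocycle_cond lambda k & ~ (odd k /\ lambda = - (k./2%:R / 2))].
Proof.
move=> ss; have muB (r : K) : (mu - lambda = r) <-> (mu = lambda + r).
  by split=> [<-|->]; [rewrite addrC subrK|rewrite [lambda + r]addrC addrK].
split=> [[[/muB E l0]|[/muB E|[[/muB E l0]|[[/muB E l0]|[/muB E l0]]]]]|].
- by exists 3%N; split=> //; [constructor 1|case].
- exists 4%N; split=> //; [|by constructor 1|by case].
  by rewrite E; congr (_ + _); field.
- exists 5%N; split=> //; first by constructor 1.
  by case=> _; rewrite divff ?pnatr_eq0.
- exists 6%N; split=> //; [|constructor 2; split=> //|by case].
    by rewrite E; congr (_ + _); field.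
  by case: l0 => ->; field.
- exists 8%N; split=> //; [|constructor 3; split=> //|by case].
    by rewrite E; congr (_ + _); field.
  transitivity ((s ^+ 2 - 33) / 8); last by rewrite ss subrr mul0r.
  by case: l0 => ->; field.
case=> k []; rewrite !inE => /or4P[/eqP->|/eqP->|/eqP->|/orP[]/eqP->] /muB E.
- by move=> _ nodd; left; split=> // l0; apply: nodd.
- by move=> _ _; right; left; rewrite E; field.
- move=> _ nodd; right; right; left; split=> // l0; apply: nodd; split=> //.
  by rewrite /= divff ?pnatr_eq0.
- case=> [//|[_ l0]|[]//] _; right; right; right; left.
  split; first by rewrite E; field.
  move/eqP: l0; rewrite mulf_eq0 => /orP[/eqP->|/eqP l0]; [by left|right].
  by apply/eqP; rewrite -subr_eq0 -[X in _ == X](mul0r (2^-1)) -l0; apply/eqP;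
    field.
case=> [//|[]//|[_ l0]] _; right; right; right; right.
split; first by rewrite E; field.
(* Completing the square: [8 (2 lambda ^ 2 + 7 lambda + 2) = (4 lambda + 7) ^ 2 - 33]. *)
have : (4 * lambda + 7 - s) * (4 * lambda + 7 + s) == 0.
  apply/eqP; transitivity (8 * (2 * lambda ^+ 2 + 7 * lambda + 2) + (33 - s ^+ 2)).
    by ring.
  by rewrite l0 ss subrr mulr0 addr0.
rewrite mulf_eq0 => /orP[]/eqP sl; [left|right].
  by rewrite -[s]addr0 -sl; field.
by rewrite -[s]subr0 -sl; field.
Qed.

Lemma H1_classification lambda mu s : s ^+ 2 = 33 ->
  [/\ exceptional lambda mu s -> H1_dim lambda mu 1,
      ~ exceptional lambda mu s -> H1_dim lambda mu 0 &
      forall n : nat, n \in [:: 3; 4; 5; 6; 8]%N ->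
        mu = lambda + n%:R / 2 -> exceptional lambda mu s ->
        is_supertransvectant lambda n (Upsilon lambda n) /\
        H1_spanned_by lambda mu (Upsilon lambda n)].
Proof.
move=> /exceptionalP exc.
split=> [/exc[k [kP -> coc nodd]]|nexc|n nP muE /exc[k [kP muE' coc nodd]]].
- by case: (H1_Upsilon kP coc nodd).
- by apply: H1_zero => /exc.
have -> : n = k.
  apply/eqP; rewrite -(eqr_nat K); move: muE; rewrite muE' => /addrI/(mulIf _) ->//.
  by rewrite invr_eq0 pnatr_eq0.
by rewrite muE'; case: (H1_Upsilon kP coc nodd).
Qed.

End FirstCohomology.

(** * The real and complex ground fields *)

Unset Implicit Arguments.

Lemma sqrt33_sqr (R : realType) (k : ground_field) :
  of_real k (Num.sqrt (33 : R)) ^+ 2 = 33 :> base_field R k.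
Proof.
have r33 : Num.sqrt (33 : R) ^+ 2 = 33 by rewrite sqr_sqrtr ?ler0n.
case: k => //=.
by rewrite -[LHS]/((real_complex R (Num.sqrt 33)) ^+ 2) -rmorphXn /= r33 rmorph_nat.
Qed.

Theorem theorem4p5 (R : realType) (k : ground_field) (lambda mu : base_field R k) :
  let sqrt33 : base_field R k := of_real k (Num.sqrt (33 : R)) in
  let exceptional : Prop :=
    (mu - lambda = 3 / 2 /\ lambda <> - (1 / 2)) \/
    (mu - lambda = 2) \/
    (mu - lambda = 5 / 2 /\ lambda <> - 1) \/
    (mu - lambda = 3 /\ (lambda = 0 \/ lambda = - (5 / 2))) \/
    (mu - lambda = 4 /\
       (lambda = (- 7 + sqrt33) / 4 \/ lambda = (- 7 - sqrt33) / 4)) in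
  [/\ exceptional -> H1_dim lambda mu 1,
      ~ exceptional -> H1_dim lambda mu 0 &
      forall n : nat, n \in [:: 3; 4; 5; 6; 8]%N ->
        mu = lambda + n%:R / 2 -> exceptional ->
        is_supertransvectant lambda n (Upsilon lambda n) /\
        H1_spanned_by lambda mu (Upsilon lambda n)].
Proof.
by move=> sqrt33; apply: H1_classification; exact: sqrt33_sqr.
Qed.
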